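(* Let $\mu$ be a strictly aperiodic probability measure on $\mathbb{Z}$ with finite second moment, $\sum_{k\in\mathbb{Z}}k^2\mu(k)<\infty$, which is centered, i.e. $\sum_{k\in\mathbb{Z}}k\mu(k)=0$. Then $\mu\in\mathcal{H}\cap\mathcal{R}$, that is, $\mu$ satisfies hypothesis (H) and $\mu$ is Ritt.
   Context: For a finite measure $\mu$ on $\mathbb{Z}$, $\hat\mu(\theta)=\sum_{n\in\mathbb{Z}}\mu(n)e^{in\theta}$; $\mu^{*n}$ is the $n$-th convolution power. A probability measure $\mu$ on $\mathbb{Z}$ is strictly aperiodic if $|\hat\mu(\theta)|<1$ for every $\theta\in(0,2\pi)$. Hypothesis (H): a probability measure $\mu$ on $\mathbb{Z}$ satisfies (H) if $\hat\mu$ is twice continuously differentiable on $[-\pi,\pi]\setminus\{0\}$ and there exist an even continuous function $\psi$ on $[-\pi,\pi]$, vanishing at $0$ and continuously differentiable on $[-\pi,\pi]\setminus\{0\}$, and constants $c,C>0$ such that for every $\theta\in(0,\pi]$: $|\hat\mu(\theta)|\le 1-c\psi(\theta)$; $|\theta\hat\mu'(\theta)|\le C\psi(\theta)$; $|\hat\mu'(\theta)|\le C\psi'(\theta)$; $|\theta\hat\mu''(\theta)|\le C\psi'(\theta)$. $\mathcal{H}$ denotes the set of probability measures satisfying (H). Ritt: $\mu$ is Ritt if $\sup_{n\ge1}n\|\mu^{*n}-\mu^{*(n+1)}\|_{\ell^1(\mathbb{Z})}<\infty$. $\mathcal{R}$ denotes the set of Ritt probability measures on $\mathbb{Z}$.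 *)

(* Defs.v *)
From Stdlib Require Import Reals ZArith.
From Coquelicot Require Import Coquelicot.
Open Scope R_scope.

(* The two half-sums are required to converge separately. *)
Definition is_Zsum (f : Z -> R) (l : R) : Prop :=
  exists a b : R,
    is_series (fun n : nat => f (Z.of_nat n)) a /\
    is_series (fun n : nat => f (- Z.of_nat (S n))%Z) b /\
    l = a + b.

Definition ex_Zsum (f : Z -> R) : Prop := exists l : R, is_Zsum f l.

(* Total version; meaningful only when both half-sums converge, as they do
   for absolutely summable families. *)
Definition Zsum (f : Z -> R) : R :=
  Series (fun n : nat => f (Z.of_nat n)) +
  Series (fun n : nat => f (- Z.of_nat (S n))%Z).

Definition CZsum (f : Z -> C) : C :=
  (Zsum (fun k => Re (f k)), Zsum (fun k => Im (f k))).

Definition is_probability (mu : Z -> R) : Prop :=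
  (forall k : Z, 0 <= mu k) /\ is_Zsum mu 1.

(* exp (i t) *)
Definition cis (t : R) : C := (cos t, sin t).

Definition fourier (mu : Z -> R) (theta : R) : C :=
  CZsum (fun n : Z => (RtoC (mu n) * cis (IZR n * theta))%C).

Definition dirac0 (k : Z) : R := if Z.eq_dec k 0 then 1 else 0.

Definition conv (mu nu : Z -> R) (k : Z) : R :=
  Zsum (fun j : Z => mu j * nu (k - j)%Z).

Fixpoint conv_pow (mu : Z -> R) (n : nat) : Z -> R :=
  match n with
  | O => dirac0
  | S m => conv mu (conv_pow mu m)
  end.

Definition strictly_aperiodic (mu : Z -> R) : Prop :=
  forall theta : R, 0 < theta < 2 * PI -> Cmod (fourier mu theta) < 1.

Definition continuous_within {V : NormedModule R_AbsRing}
    (D : R -> Prop) (f : R -> V) (x : R) : Prop :=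
  filterlim f (within D (locally x)) (locally (f x)).

(* At an interior point of D this is [is_derive]; at an endpoint of an
   interval it is the one-sided derivative. *)
Definition is_derive_within {V : NormedModule R_AbsRing}
    (D : R -> Prop) (f : R -> V) (x : R) (l : V) : Prop :=
  filterdiff f (within D (locally x)) (fun h : R => scal h l).

Definition is_C1_on {V : NormedModule R_AbsRing}
    (D : R -> Prop) (f df : R -> V) : Prop :=
  forall x : R, D x -> is_derive_within D f x (df x) /\ continuous_within D df x.

Definition seg_pi (x : R) : Prop := - PI <= x <= PI.

Definition seg_pi_punctured (x : R) : Prop := seg_pi x /\ x <> 0.

(* The derivatives use [C_R_NormedModule], since theta is a real variable; the
   canonical normed module structure on [C] is over [C]. *)
Definition hypothesis_H (mu : Z -> R) : Prop :=
  exists d1 d2 : R -> C,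
    is_C1_on (V := C_R_NormedModule) seg_pi_punctured (fourier mu) d1 /\
    is_C1_on (V := C_R_NormedModule) seg_pi_punctured d1 d2 /\
    exists (psi dpsi : R -> R) (c C : R),
      (forall x : R, seg_pi x -> psi (- x) = psi x) /\
      (forall x : R, seg_pi x -> continuous_within seg_pi psi x) /\
      psi 0 = 0 /\
      is_C1_on seg_pi_punctured psi dpsi /\
      0 < c /\ 0 < C /\
      forall theta : R, 0 < theta <= PI ->
        Cmod (fourier mu theta) <= 1 - c * psi theta /\
        Cmod (RtoC theta * d1 theta)%C <= C * psi theta /\
        Cmod (d1 theta) <= C * dpsi theta /\
        Cmod (RtoC theta * d2 theta)%C <= C * dpsi theta.

Definition class_H (mu : Z -> R) : Prop := is_probability mu /\ hypothesis_H mu.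

Definition ritt (mu : Z -> R) : Prop :=
  exists M : R, forall n : nat, (1 <= n)%nat ->
    exists l : R,
      is_Zsum (fun k : Z => Rabs (conv_pow mu n k - conv_pow mu (S n) k)) l /\
      INR n * l <= M.

Definition class_R (mu : Z -> R) : Prop := is_probability mu /\ ritt mu.

(* Main.v *)
Require Import Defs.
From Stdlib Require Import Reals ZArith Lra Lia Psatz.
From Coquelicot Require Import Coquelicot.
Open Scope R_scope.

(** Both conclusions follow from the behaviour of the Fourier transform [z] of
    [mu] near 0: for some [c, L > 0] and all [t] in [[- PI, PI]],
      [|z t| <= 1 - c t^2], [|1 - z t| <= L t^2], [|z' t| <= L |t|] and
      [|z'' t| <= L]  (lemma [fourier_estimates]).
    The last three hold because the second moment makes [z] twice continuously
    differentiable and centering gives [z' 0 = 0].  The first one comes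
    from strict aperiodicity: the inequality
      [1 - |z (2 t)|^2 <= 4 (1 - |z t|^2)]  (lemma [fourier_double])
    propagates the positive lower bound of [1 - |z|^2] on [[PI / 2, PI]] down to
    0 with quadratic rate.

    Hypothesis (H) then holds with [psi t = t^2].

    For the Ritt property, the differences of consecutive convolution powers
    are the Fourier coefficients [a_k] of [W = z^n - z^(n+1)] (lemma
    [conv_pow_coef]).  The estimates on [z] make [|z|^n] decay like a Gaussian of
    width [n^(-1/2)] and show that the mean squares of [W] and [W'] over a period
    are of order [n^(-5/2)] and [n^(-3/2)] (lemma [energy_pow_gap_le]).  By
    Bessel's inequality these dominate the sums of [a_k^2] and of [k^2 a_k^2],
    and the Cauchy-Schwarz inequality with the weights [n + k^2] yields
    [sum |a_k| = O(1/n)] (lemma [coef_abs_sum_le]). *)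

(** * Dominated series of functions *)

Lemma ex_series_dominated (u M : nat -> R) :
  (forall n, Rabs (u n) <= M n) -> ex_series M -> ex_series u.
Proof. intros Hu HM. apply (ex_series_le u M); auto. Qed.

Lemma Series_tail_le (u M : nat -> R) (n : nat) :
  (forall n, Rabs (u n) <= M n) -> ex_series M ->
  Rabs (Series u - sum_n u n) <= Series M - sum_n M n.
Proof.
  intros Hu HM.
  assert (Eu : ex_series u) by (eapply ex_series_dominated; eauto).
  rewrite (Series_incr_n u (S n)), (Series_incr_n M (S n)); auto; try lia.
  rewrite !sum_n_Reals; simpl pred.
  assert (EM' : ex_series (fun k => M (S n + k)%nat)).
  { apply (ex_series_incr_n M (S n)); auto. }
  match goal with |- Rabs (?a + ?b - ?a) <= ?c + ?d - ?c =>
    replace (a + b - a) with b by ring; replace (c + d - c) with d by ring end.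
  assert (Ea : ex_series (fun k => Rabs (u (S n + k)%nat))).
  { apply (ex_series_dominated _ (fun k => M (S n + k)%nat)); auto.
    intro k; rewrite Rabs_Rabsolu; auto. }
  eapply Rle_trans; [apply Series_Rabs; auto|].
  apply Series_le; auto. intro k; split; [apply Rabs_pos|auto].
Qed.

Lemma Mtest_uniform (F : nat -> R -> R) (M : nat -> R) :
  (forall n x, Rabs (F n x) <= M n) -> ex_series M ->
  forall eps, 0 < eps -> exists N, forall n, (N <= n)%nat ->
    forall x, Rabs (Series (fun k => F k x) - sum_n (fun k => F k x) n) < eps.
Proof.
  intros HF HM eps He.
  destruct (proj1 (is_series_Reals _ _) (Series_correct _ HM) eps He) as [N HN].
  exists N; intros n Hn x.
  eapply Rle_lt_trans; [apply (Series_tail_le (fun k => F k x) M n); auto|].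
  specialize (HN n Hn). unfold Rdist in HN. rewrite sum_n_Reals.
  apply Rabs_def2 in HN. lra.
Qed.

Lemma continuous_sum_n (F : nat -> R -> R) (x : R) n :
  (forall k, continuous (F k) x) -> continuous (fun y => sum_n (fun k => F k y) n) x.
Proof.
  intros HF. induction n as [|n IH].
  - apply (continuous_ext (F 0%nat)); auto. intros y; now rewrite sum_O.
  - apply (continuous_ext (fun y => plus (sum_n (fun k => F k y) n) (F (S n) y))).
    + intros y; now rewrite sum_Sn.
    + apply (continuous_plus (V := R_NormedModule)); auto.
Qed.

Lemma continuous_Series (F : nat -> R -> R) (M : nat -> R) (x : R) :
  (forall n x, Rabs (F n x) <= M n) -> ex_series M ->
  (forall n, continuous (F n) x) ->
  continuous (fun y => Series (fun k => F k y)) x.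
Proof.
  intros HF HM HC. apply continuity_pt_filterlim.
  intros eps He.
  destruct (Mtest_uniform F M HF HM (eps/3)) as [N HN]; [lra|].
  specialize (HN N (Nat.le_refl _)).
  assert (Hc := continuous_sum_n F x N HC).
  apply continuity_pt_filterlim in Hc.
  destruct (Hc (eps/3)) as [d [Hd Hc']]; [lra|].
  exists d; split; auto. intros y Hy. specialize (Hc' y Hy).
  simpl in *. unfold Rdist in *.
  assert (H1 := HN x); assert (H2 := HN y).
  apply Rabs_def2 in H1; apply Rabs_def2 in H2; apply Rabs_def2 in Hc'.
  apply Rabs_def1; lra.
Qed.

Lemma is_RInt_sum_n (F : nat -> R -> R) (a b : R) n :
  (forall k, ex_RInt (F k) a b) ->
  is_RInt (fun x => sum_n (fun k => F k x) n) a b (sum_n (fun k => RInt (F k) a b) n).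
Proof.
  intros HF. induction n as [|n IH].
  - apply (is_RInt_ext (F 0%nat)); [intros x _; now rewrite sum_O|].
    rewrite sum_O. apply (RInt_correct (V := R_CompleteNormedModule)); auto.
  - apply (is_RInt_ext (fun x => plus (sum_n (fun k => F k x) n) (F (S n) x))).
    + intros x _; now rewrite sum_Sn.
    + rewrite sum_Sn. apply (is_RInt_plus (V := R_NormedModule)); auto.
      apply (RInt_correct (V := R_CompleteNormedModule)); auto.
Qed.

(** Partial sums converge uniformly, so integration passes to the limit. *)
Lemma is_series_RInt (F : nat -> R -> R) (M : nat -> R) (a b : R) :
  (forall n x, Rabs (F n x) <= M n) -> ex_series M ->
  (forall n x, continuous (F n) x) ->
  is_series (fun n => RInt (F n) a b) (RInt (fun x => Series (fun n => F n x)) a b).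
Proof.
  intros HF HM HC.
  assert (HI : forall k, ex_RInt (F k) a b).
  { intro k; apply (ex_RInt_continuous (V := R_CompleteNormedModule)); auto. }
  destruct (filterlim_RInt (V := R_CompleteNormedModule)
    (fun n x => sum_n (fun k => F k x) n) a b eventually _
    (fun x => Series (fun n => F n x)) (fun n => sum_n (fun k => RInt (F k) a b) n))
    as [l [Hl1 Hl2]].
  - intro n; apply is_RInt_sum_n; auto.
  - apply filterlim_locally. intros eps.
    destruct (Mtest_uniform F M HF HM eps (cond_pos eps)) as [N HN].
    exists N; intros n Hn x. specialize (HN n Hn x).
    unfold ball; simpl; unfold AbsRing_ball, abs, minus, plus, opp; simpl.
    rewrite Rabs_minus_sym in HN. exact HN.
  - rewrite (is_RInt_unique _ _ _ _ Hl2). exact Hl1.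
Qed.

Lemma is_Zsum_unique f l : is_Zsum f l -> Zsum f = l.
Proof.
  intros (a & b & Ha & Hb & ->). unfold Zsum.
  now rewrite (is_series_unique _ _ Ha), (is_series_unique _ _ Hb).
Qed.

Lemma Zsum_correct f : ex_Zsum f -> is_Zsum f (Zsum f).
Proof. intros [l Hl]. now rewrite (is_Zsum_unique _ _ Hl). Qed.

Lemma ex_Zsum_halves f : ex_Zsum f <->
  ex_series (fun n => f (Z.of_nat n)) /\ ex_series (fun n => f (- Z.of_nat (S n))%Z).
Proof.
  split.
  - intros (l & a & b & Ha & Hb & _); split; eexists; eauto.
  - intros [[a Ha] [b Hb]]. exists (a + b), a, b; auto.
Qed.

Lemma is_Zsum_ext f g l : (forall k, f k = g k) -> is_Zsum f l -> is_Zsum g l.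
Proof.
  intros E (a & b & Ha & Hb & ->). exists a, b; repeat split; auto.
  - eapply is_series_ext; [|exact Ha]; simpl; auto.
  - eapply is_series_ext; [|exact Hb]; simpl; auto.
Qed.

Lemma Zsum_ext f g : (forall k, f k = g k) -> Zsum f = Zsum g.
Proof. intro E. unfold Zsum. f_equal; apply Series_ext; auto. Qed.

Lemma is_Zsum_plus f g l m : is_Zsum f l -> is_Zsum g m ->
  is_Zsum (fun k => f k + g k) (l + m).
Proof.
  intros (a & b & Ha & Hb & ->) (a' & b' & Ha' & Hb' & ->).
  exists (a + a'), (b + b'); repeat split; try ring.
  - exact (is_series_plus _ _ _ _ Ha Ha').
  - exact (is_series_plus _ _ _ _ Hb Hb').
Qed.

Lemma is_Zsum_scal c f l : is_Zsum f l -> is_Zsum (fun k => c * f k) (c * l).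
Proof.
  intros (a & b & Ha & Hb & ->).
  exists (c * a), (c * b); repeat split; try ring.
  - exact (is_series_scal_l c _ _ Ha).
  - exact (is_series_scal_l c _ _ Hb).
Qed.

Lemma ex_Zsum_dominated f M : (forall k, Rabs (f k) <= M k) -> ex_Zsum M -> ex_Zsum f.
Proof.
  intros H HM. apply ex_Zsum_halves in HM. destruct HM as [H1 H2].
  apply ex_Zsum_halves; split.
  - eapply ex_series_dominated; [|exact H1]; simpl; auto.
  - eapply ex_series_dominated; [|exact H2]; simpl; auto.
Qed.

Lemma is_series_nonneg (u : nat -> R) l : (forall n, 0 <= u n) -> is_series u l -> 0 <= l.
Proof.
  intros Hu Hl. rewrite <- (is_series_unique _ _ Hl).
  replace 0 with (Series (fun n => 0 * u n)).
  - apply Series_le; [|eexists; eauto]. intro n; specialize (Hu n); lra.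
  - rewrite Series_scal_l; ring.
Qed.

Lemma is_Zsum_le f g l m : (forall k, f k <= g k) -> is_Zsum f l -> is_Zsum g m -> l <= m.
Proof.
  intros H Hf Hg.
  assert (Hd : is_Zsum (fun k => g k + (-1) * f k) (m + (-1) * l))
    by (apply is_Zsum_plus; auto; apply is_Zsum_scal; auto).
  destruct Hd as (a & b & Ha & Hb & E).
  assert (0 <= a) by (eapply is_series_nonneg; [|exact Ha]; intro n; simpl; specialize (H (Z.of_nat n)); lra).
  assert (0 <= b) by (eapply is_series_nonneg; [|exact Hb]; intro n; cbv beta;
    specialize (H (- Z.of_nat (S n))%Z); lra).
  lra.
Qed.

Lemma Zsum_abs_le f M : (forall k, Rabs (f k) <= M k) -> ex_Zsum M -> Rabs (Zsum f) <= Zsum M.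
Proof.
  intros H HM. assert (Hf := Zsum_correct _ (ex_Zsum_dominated _ _ H HM)).
  apply Zsum_correct in HM. apply Rabs_le; split.
  - replace (- Zsum M) with ((-1) * Zsum M) by ring.
    apply (is_Zsum_le (fun k => (-1) * M k) f); [|apply is_Zsum_scal; exact HM|exact Hf].
    intro k. specialize (H k). apply Rabs_le_between in H. lra.
  - eapply is_Zsum_le; [|exact Hf|exact HM]. intro k; simpl.
    eapply Rle_trans; [apply Rle_abs|auto].
Qed.

Section Mtest.
Variables (F : Z -> R -> R) (M : Z -> R).
Hypothesis F_dom : forall k x, Rabs (F k x) <= M k.
Hypothesis M_sum : ex_Zsum M.

Lemma continuous_Zsum x : (forall k, continuous (F k) x) ->
  continuous (fun y => Zsum (fun k => F k y)) x.
Proof.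
  intros HC. apply ex_Zsum_halves in M_sum. destruct M_sum as [H1 H2].
  apply (continuous_plus (V := R_NormedModule)
    (fun y => Series (fun n => F (Z.of_nat n) y))
    (fun y => Series (fun n => F (- Z.of_nat (S n))%Z y))).
  - apply (continuous_Series (fun n => F (Z.of_nat n)) _ x (fun n x => F_dom _ x) H1); auto.
  - apply (continuous_Series (fun n => F (- Z.of_nat (S n))%Z) _ x (fun n x => F_dom _ x) H2); auto.
Qed.

Lemma is_Zsum_RInt a b : (forall k x, continuous (F k) x) ->
  is_Zsum (fun k => RInt (F k) a b) (RInt (fun x => Zsum (fun k => F k x)) a b).
Proof.
  intros HC. apply ex_Zsum_halves in M_sum. destruct M_sum as [H1 H2].
  eexists; eexists; split; [|split].
  - exact (is_series_RInt (fun n => F (Z.of_nat n)) _ a b (fun n x => F_dom _ x) H1 (fun n => HC _)).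
  - exact (is_series_RInt (fun n => F (- Z.of_nat (S n))%Z) _ a b (fun n x => F_dom _ x) H2 (fun n => HC _)).
  - apply (RInt_plus (V := R_CompleteNormedModule));
      apply (ex_RInt_continuous (V := R_CompleteNormedModule)); intros z _.
    + apply (continuous_Series (fun n => F (Z.of_nat n)) _ z (fun n x => F_dom _ x) H1); auto.
    + apply (continuous_Series (fun n => F (- Z.of_nat (S n))%Z) _ z (fun n x => F_dom _ x) H2); auto.
Qed.
End Mtest.

(** Integrating the dominated series of derivatives term by term exhibits the
    sum as a primitive of a continuous function. *)
Lemma is_derive_Zsum (F dF : Z -> R -> R) (M dM : Z -> R) x :
  (forall k x, Rabs (F k x) <= M k) -> ex_Zsum M ->
  (forall k x, Rabs (dF k x) <= dM k) -> ex_Zsum dM ->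
  (forall k x, is_derive (F k) x (dF k x)) ->
  (forall k x, continuous (dF k) x) ->
  is_derive (fun y => Zsum (fun k => F k y)) x (Zsum (fun k => dF k x)).
Proof.
  intros HF HM HdF HdM HD HC.
  set (G := fun y => Zsum (fun k => dF k y)).
  assert (GC : forall y, continuous G y) by (intro y; apply (continuous_Zsum dF dM); auto).
  assert (E : forall y, Zsum (fun k => F k y) = Zsum (fun k => F k 0) + RInt G 0 y).
  { intro y. apply is_Zsum_unique.
    apply (is_Zsum_ext (fun k => F k 0 + RInt (dF k) 0 y)).
    - intro k.
      assert (K := is_RInt_derive (V := R_CompleteNormedModule) (F k) (dF k) 0 y
        (fun z _ => HD k z) (fun z _ => HC k z)).
      rewrite (is_RInt_unique _ _ _ _ K). unfold minus, plus, opp; simpl; ring.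
    - apply is_Zsum_plus.
      + apply Zsum_correct. apply (ex_Zsum_dominated _ M); auto.
      + apply (is_Zsum_RInt dF dM); auto. }
  apply (is_derive_ext (fun y => plus (Zsum (fun k => F k 0)) (RInt G 0 y))).
  { intro y. symmetry. apply E. }
  replace (Zsum (fun k => dF k x)) with (plus 0 (G x)) by apply Rplus_0_l.
  apply (is_derive_plus (V := R_NormedModule)); [apply (is_derive_const (V := R_NormedModule))|].
  apply (is_derive_RInt (V := R_NormedModule) G (fun y => RInt G 0 y) 0 x); auto.
  apply filter_forall. intro y. apply (RInt_correct (V := R_CompleteNormedModule)).
  apply (ex_RInt_continuous (V := R_CompleteNormedModule)); auto.
Qed.

(** * The characteristic function *)

Definition zcos (f : Z -> R) (t : R) : R := Zsum (fun k => f k * cos (IZR k * t)).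
Definition zsin (f : Z -> R) (t : R) : R := Zsum (fun k => f k * sin (IZR k * t)).

Lemma Rabs_mult_cos_le a t : Rabs (a * cos t) <= Rabs a.
Proof.
  rewrite Rabs_mult. rewrite <- (Rmult_1_r (Rabs a)) at 2.
  apply Rmult_le_compat_l; [apply Rabs_pos|apply Rabs_le, COS_bound].
Qed.

Lemma Rabs_mult_sin_le a t : Rabs (a * sin t) <= Rabs a.
Proof. rewrite <- cos_shift. apply Rabs_mult_cos_le. Qed.

Lemma Zsum_scal c f : Zsum (fun k => c * f k) = c * Zsum f.
Proof. unfold Zsum. rewrite !Series_scal_l. ring. Qed.

Lemma continuous_of_is_derive (f df : R -> R) x : is_derive f x (df x) -> continuous f x.
Proof. intro H. exact (ex_derive_continuous (K:=R_AbsRing) (V:=R_NormedModule) f x (ex_intro _ _ H)). Qed.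

Section TrigSeries.
Variable f : Z -> R.
Hypothesis f_sum : ex_Zsum (fun k => Rabs (f k)).

Lemma zcos_abs_le t : Rabs (zcos f t) <= Zsum (fun k => Rabs (f k)).
Proof. apply Zsum_abs_le; auto. intro; apply Rabs_mult_cos_le. Qed.

Lemma zsin_abs_le t : Rabs (zsin f t) <= Zsum (fun k => Rabs (f k)).
Proof. apply Zsum_abs_le; auto. intro; apply Rabs_mult_sin_le. Qed.

Lemma is_Zsum_zcos t : is_Zsum (fun k => f k * cos (IZR k * t)) (zcos f t).
Proof.
  apply Zsum_correct, (ex_Zsum_dominated _ (fun k => Rabs (f k))); auto.
  intro; apply Rabs_mult_cos_le.
Qed.

Lemma is_Zsum_zsin t : is_Zsum (fun k => f k * sin (IZR k * t)) (zsin f t).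
Proof.
  apply Zsum_correct, (ex_Zsum_dominated _ (fun k => Rabs (f k))); auto.
  intro; apply Rabs_mult_sin_le.
Qed.

Lemma continuous_zcos t : continuous (zcos f) t.
Proof.
  apply (continuous_Zsum (fun k t => f k * cos (IZR k * t)) (fun k => Rabs (f k))); auto.
  - intros; apply Rabs_mult_cos_le.
  - intro k. apply (ex_derive_continuous (K := R_AbsRing) (V := R_NormedModule)). auto_derive; auto.
Qed.

Lemma continuous_zsin t : continuous (zsin f) t.
Proof.
  apply (continuous_Zsum (fun k t => f k * sin (IZR k * t)) (fun k => Rabs (f k))); auto.
  - intros; apply Rabs_mult_sin_le.
  - intro k. apply (ex_derive_continuous (K := R_AbsRing) (V := R_NormedModule)). auto_derive; auto.
Qed.

Hypothesis kf_sum : ex_Zsum (fun k => Rabs (IZR k * f k)).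

Lemma is_derive_zcos t : is_derive (zcos f) t (- zsin (fun k => IZR k * f k) t).
Proof.
  replace (- zsin (fun k => IZR k * f k) t)
    with (Zsum (fun k => (-1) * (IZR k * f k * sin (IZR k * t))))
    by (rewrite Zsum_scal; unfold zsin; ring).
  apply (is_derive_Zsum (fun k t => f k * cos (IZR k * t))
    (fun k t => (-1) * (IZR k * f k * sin (IZR k * t)))
    (fun k => Rabs (f k)) (fun k => Rabs (IZR k * f k))); auto.
  - intros; apply Rabs_mult_cos_le.
  - intros k x. replace (-1 * (IZR k * f k * sin (IZR k * x))) with (- (IZR k * f k * sin (IZR k * x))) by ring.
    rewrite Rabs_Ropp. apply Rabs_mult_sin_le.
  - intros; auto_derive; auto. ring.
  - intros; apply (ex_derive_continuous (K := R_AbsRing) (V := R_NormedModule)); auto_derive; auto.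
Qed.

Lemma is_derive_zsin t : is_derive (zsin f) t (zcos (fun k => IZR k * f k) t).
Proof.
  apply (is_derive_Zsum (fun k t => f k * sin (IZR k * t))
    (fun k t => IZR k * f k * cos (IZR k * t))
    (fun k => Rabs (f k)) (fun k => Rabs (IZR k * f k))); auto.
  - intros; apply Rabs_mult_sin_le.
  - intros k x. apply Rabs_mult_cos_le.
  - intros; auto_derive; auto. ring.
  - intros; apply (ex_derive_continuous (K := R_AbsRing) (V := R_NormedModule)); auto_derive; auto.
Qed.
End TrigSeries.

Lemma zcos_opp f t : zcos f (- t) = zcos f t.
Proof.
  apply Zsum_ext; intro k. rewrite Ropp_mult_distr_r_reverse, cos_neg. reflexivity.
Qed.

Lemma zsin_opp f t : zsin f (- t) = - zsin f t.
Proof.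
  replace (- zsin f t) with ((-1) * zsin f t) by ring. unfold zsin. rewrite <- Zsum_scal.
  apply Zsum_ext; intro k. rewrite Ropp_mult_distr_r_reverse, sin_neg. ring.
Qed.

Lemma zsin_PI f : zsin f PI = 0.
Proof.
  replace 0 with (0 * zsin f PI) by ring. unfold zsin. rewrite <- Zsum_scal.
  apply Zsum_ext; intro k. rewrite (sin_eq_0_1 (IZR k * PI)); [ring|eauto].
Qed.

Lemma fourier_eq mu t : fourier mu t = (zcos mu t, zsin mu t).
Proof.
  unfold fourier, CZsum, zcos, zsin. f_equal; apply Zsum_ext; intro k; simpl; ring.
Qed.

Lemma Rabs_diff_le_derive (f df : R -> R) (K x : R) :
  (forall t, is_derive f t (df t)) -> (forall t, Rabs t <= Rabs x -> Rabs (df t) <= K) ->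
  Rabs (f x - f 0) <= K * Rabs x.
Proof.
  intros HD HK.
  destruct (MVT_gen f 0 x df) as (c & Hc & E).
  - auto.
  - intros t _. apply continuity_pt_filterlim. apply (continuous_of_is_derive f df); auto.
  - rewrite E, Rminus_0_r, Rabs_mult. apply Rmult_le_compat_r; [apply Rabs_pos|].
    apply HK. revert Hc. unfold Rmin, Rmax. destruct (Rle_dec 0 x); intros [H1 H2].
    + rewrite !Rabs_pos_eq; lra.
    + rewrite !Rabs_left1; lra.
Qed.

Lemma Cmod_le_components (x y : R) : Cmod (x, y) <= Rabs x + Rabs y.
Proof.
  unfold Cmod; simpl. apply Rsqr_incr_0_var.
  - rewrite Rsqr_sqrt by nra. unfold Rsqr.
    pose proof (Rabs_pos x); pose proof (Rabs_pos y).
    pose proof (pow2_abs x); pose proof (pow2_abs y). nra.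
  - pose proof (Rabs_pos x); pose proof (Rabs_pos y). lra.
Qed.

Lemma Cmod_sqr (z : C) : Cmod z ^ 2 = fst z ^ 2 + snd z ^ 2.
Proof. unfold Cmod. rewrite pow2_sqrt; auto. simpl; nra. Qed.

Section CharFun.
Variable mu : Z -> R.
Hypothesis mu_prob : is_probability mu.

Let mu_pos k : 0 <= mu k := proj1 mu_prob k.
Let mu_one : is_Zsum mu 1 := proj2 mu_prob.

Lemma prob_abs_sum : ex_Zsum (fun k => Rabs (mu k)).
Proof.
  exists 1. eapply is_Zsum_ext; [|exact mu_one]. intro k; simpl; symmetry.
  apply Rabs_pos_eq, mu_pos.
Qed.

Let A := zcos mu.
Let B := zsin mu.
(* [r t] is the squared modulus of the transform, and [y t k] is the real part
   of [cis (k t)] times the conjugate of the transform at [t]. *)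
Let r t := A t ^ 2 + B t ^ 2.
Let y t k := A t * cos (IZR k * t) + B t * sin (IZR k * t).

Lemma is_Zsum_rotated t : is_Zsum (fun k => mu k * y t k) (r t).
Proof.
  replace (r t) with (A t * A t + B t * B t) by (unfold r; ring).
  apply (is_Zsum_ext (fun k => A t * (mu k * cos (IZR k * t)) + B t * (mu k * sin (IZR k * t)))).
  { intro k; unfold y; ring. }
  apply is_Zsum_plus; apply is_Zsum_scal.
  - apply is_Zsum_zcos, prob_abs_sum.
  - apply is_Zsum_zsin, prob_abs_sum.
Qed.

(** Pointwise [y t k <= (1 + r t) / 2]; the mean of the left side is [r t]. *)
Lemma fourier_sqr_le_1 t : zcos mu t ^ 2 + zsin mu t ^ 2 <= 1.
Proof.
  change (r t <= 1).
  assert (r t <= (1 + r t) / 2 * 1); [|lra].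
  apply (is_Zsum_le (fun k => mu k * y t k) (fun k => (1 + r t) / 2 * mu k)).
  - intro k. rewrite Rmult_comm. apply Rmult_le_compat_r; [apply mu_pos|].
    pose proof (sin2_cos2 (IZR k * t)) as E. unfold Rsqr in E.
    unfold y, r. revert E. generalize (cos (IZR k * t)) (sin (IZR k * t)) (A t) (B t).
    intros c s a b E.
    pose proof (pow2_ge_0 (a - c)); pose proof (pow2_ge_0 (b - s)). nra.
  - apply is_Zsum_rotated.
  - apply is_Zsum_scal; auto.
Qed.

(** Let [z] be the transform at [t].  The real part of the transform at [2 t]
    times the square of the conjugate of [z] is the mean of [2 y^2 - r], where
    [y] has mean [r]; since a square has mean at least [r^2], this real part is
    at least [2 r^2 - r].  Hence the modulus at [2 t] is at least [2 r - 1].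
    If [r >= 1 / 2], conclude by [1 - (2 r - 1)^2 <= 4 (1 - r)]; otherwise the
    right-hand side exceeds 1. *)
Lemma fourier_double t :
  1 - (zcos mu (2*t) ^ 2 + zsin mu (2*t) ^ 2) <= 4 * (1 - (zcos mu t ^ 2 + zsin mu t ^ 2)).
Proof.
  change (1 - r (2*t) <= 4 * (1 - r t)).
  set (a := A t); set (b := B t).
  set (X := (a^2 - b^2) * A (2*t) + 2*a*b * B (2*t)).
  assert (HX : 2 * r t ^ 2 - r t <= X).
  { assert (E : 2 * r t ^ 2 - r t = 4 * r t * r t + - (2 * r t ^ 2 + r t) * 1) by ring.
    rewrite E.
    apply (is_Zsum_le (fun k => 4 * r t * (mu k * y t k) + - (2 * r t ^ 2 + r t) * mu k)
      (fun k => (a^2 - b^2) * (mu k * cos (IZR k * (2*t))) + 2*a*b * (mu k * sin (IZR k * (2*t))))).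
    - intro k. replace (IZR k * (2 * t)) with (2 * (IZR k * t)) by ring.
      rewrite cos_2a, sin_2a.
      pose proof (sin2_cos2 (IZR k * t)) as E1. unfold Rsqr in E1.
      set (c := cos _) in *; set (s := sin _) in *.
      assert (E2 : (a^2 - b^2) * (mu k * (c*c - s*s)) + 2*a*b*(mu k * (2*s*c))
        = mu k * (2 * y t k ^ 2 - r t)).
      { unfold y, r. fold c s a b. replace (a^2+b^2) with ((a^2+b^2) * (s*s+c*c)) by (rewrite E1; ring).
        ring. }
      rewrite E2. pose proof (mu_pos k).
      pose proof (pow2_ge_0 (y t k - r t)) as E3. revert E3.
      generalize (y t k) (r t). intros u v E3.
      assert (0 <= mu k * (u - v)^2) by (apply Rmult_le_pos; auto). nra.
    - apply is_Zsum_plus; apply is_Zsum_scal; auto. apply is_Zsum_rotated.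
    - apply is_Zsum_plus; apply is_Zsum_scal; [apply is_Zsum_zcos|apply is_Zsum_zsin];
        apply prob_abs_sum. }
  assert (H0 : 0 <= r t) by (unfold r; nra).
  pose proof (fourier_sqr_le_1 t) as H1. change (r t <= 1) in H1.
  assert (H2 : 0 <= r (2*t)) by (unfold r; nra).
  assert (HCS : X ^ 2 <= r t ^ 2 * r (2*t)).
  { unfold X, r. fold a b. set (p := A (2*t)); set (q := B (2*t)).
    pose proof (pow2_ge_0 ((a^2-b^2) * q - 2*a*b*p)) as E. clearbody a b p q.
    apply Rminus_le_0. eapply Rle_trans; [exact E|]. apply Req_le. ring. }
  destruct (Rle_lt_dec (r t) (1/2)) as [Hr|Hr]; [lra|].
  assert (HX2 : (2 * r t ^ 2 - r t)^2 <= r t ^ 2 * r (2*t)).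
  { eapply Rle_trans; [|exact HCS]. apply pow_incr. split; auto. nra. }
  assert (HX3 : (2 * r t - 1)^2 <= r (2*t)).
  { apply (Rmult_le_reg_l (r t ^ 2)); [nra|]. nra. }
  nra.
Qed.

Hypothesis mu_aper : strictly_aperiodic mu.

(** Continuity and strict aperiodicity bound [1 - r t] away from 0 on
    [[PI / 2, PI]]; the doubling inequality carries a quadratic lower bound from
    [2 t] to [t], hence to all of [(0, PI]]. *)
Lemma fourier_sqr_lower :
  exists c, 0 < c /\ forall t, 0 < t <= PI ->
    c * t ^ 2 <= 1 - (zcos mu t ^ 2 + zsin mu t ^ 2).
Proof.
  pose proof PI_RGT_0 as HPI.
  destruct (continuity_ab_min (fun t => 1 - (zcos mu t ^ 2 + zsin mu t ^ 2)) (PI/2) PI)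
    as (m & Hm & Hm'); [lra| |].
  { intros t _. pose proof (continuous_zcos mu prob_abs_sum t) as H1.
    pose proof (continuous_zsin mu prob_abs_sum t) as H2.
    apply continuity_pt_filterlim in H1; apply continuity_pt_filterlim in H2.
    apply continuity_pt_minus; [apply continuity_pt_const; intros ? ?; auto|].
    apply continuity_pt_plus;
      repeat first [apply continuity_pt_mult|assumption|apply continuity_pt_const; intros ? ?; auto]. }
  set (d := 1 - (zcos mu m ^ 2 + zsin mu m ^ 2)) in *.
  assert (Hd : 0 < d).
  { assert (Hap := mu_aper m ltac:(lra)). rewrite fourier_eq in Hap.
    assert (E := Cmod_sqr (zcos mu m, zsin mu m)). simpl fst in E; simpl snd in E.
    unfold d. rewrite <- E. pose proof (Cmod_ge_0 (zcos mu m, zsin mu m)). nra. }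
  assert (HP2 : 0 < PI^2) by nra.
  assert (Hc : 0 < d / PI^2) by (apply Rdiv_lt_0_compat; auto).
  exists (d / PI^2); split; auto.
  assert (Hbase : forall t, PI/2 <= t <= PI -> d / PI^2 * t^2 <= 1 - (zcos mu t ^ 2 + zsin mu t ^ 2)).
  { intros t Ht. eapply Rle_trans; [|apply Hm; auto].
    replace d with (d / PI^2 * PI^2) at 2 by (field; lra).
    apply Rmult_le_compat_l; [lra|]. apply pow_incr; lra. }
  assert (Hall : forall j t, PI / 2 ^ (S j) <= t <= PI ->
    d / PI^2 * t^2 <= 1 - (zcos mu t ^ 2 + zsin mu t ^ 2)).
  { induction j as [|j IH]; intros t Ht.
    - apply Hbase. simpl in Ht. lra.
    - destruct (Rle_lt_dec (PI/2) t) as [Hl|Hl]; [apply Hbase; lra|].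
      assert (H2 := IH (2*t)). assert (H3 := fourier_double t).
      assert (E : PI / 2 ^ S (S j) = (PI / 2 ^ S j) / 2).
      { simpl. field. apply pow_nonzero; lra. }
      rewrite E in Ht. specialize (H2 ltac:(lra)). lra. }
  intros t Ht.
  (* the number of doublings that bring [t] into [[PI / 2, PI]] *)
  destruct (pow_lt_1_zero (/2)) with (y := t / PI) as [N HN].
  { rewrite Rabs_pos_eq; lra. }
  { apply Rdiv_lt_0_compat; lra. }
  apply (Hall N). split; [|lra].
  specialize (HN (S N) ltac:(lia)). rewrite Rabs_pos_eq in HN by (apply pow_le; lra).
  rewrite pow_inv in HN. unfold Rdiv at 1.
  apply (Rmult_lt_compat_l PI) in HN; [|lra].
  replace (PI * (t / PI)) with t in HN by (field; lra). lra.
Qed.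

Hypothesis mu_mom2 : ex_Zsum (fun k : Z => (IZR k) ^ 2 * mu k).
Hypothesis mu_cent : is_Zsum (fun k : Z => IZR k * mu k) 0.

Definition times_index (f : Z -> R) (k : Z) : R := IZR k * f k.

Lemma second_moment_abs_sum : ex_Zsum (fun k => Rabs (times_index (times_index mu) k)).
Proof.
  apply (ex_Zsum_dominated _ (fun k : Z => (IZR k) ^ 2 * mu k)); auto.
  intro k. rewrite Rabs_Rabsolu. apply Req_le. unfold times_index.
  rewrite Rabs_pos_eq; [ring|]. pose proof (mu_pos k). 
  assert (0 <= (IZR k)^2 * mu k) by (apply Rmult_le_pos; auto; nra). nra.
Qed.

Lemma first_moment_abs_sum : ex_Zsum (fun k => Rabs (times_index mu k)).
Proof.
  apply (ex_Zsum_dominated _ (fun k : Z => (IZR k) ^ 2 * mu k)); auto.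
  intro k. rewrite Rabs_Rabsolu. unfold times_index. pose proof (mu_pos k).
  rewrite Rabs_mult, (Rabs_pos_eq (mu k)) by auto.
  apply Rmult_le_compat_r; auto.
  rewrite <- abs_IZR. rewrite <- (pow2_abs (IZR k)), <- abs_IZR.
  replace (IZR (Z.abs k) ^ 2) with (IZR (Z.abs k * Z.abs k)) by (rewrite mult_IZR; ring).
  apply IZR_le. nia.
Qed.

Definition dfourier (t : R) : C := (- zsin (times_index mu) t, zcos (times_index mu) t).
Definition ddfourier (t : R) : C :=
  (- zcos (times_index (times_index mu)) t, - zsin (times_index (times_index mu)) t).

Let is_derive_A t : is_derive A t (- zsin (times_index mu) t).
Proof. apply is_derive_zcos; [apply prob_abs_sum|apply first_moment_abs_sum]. Qed.
Let is_derive_B t : is_derive B t (zcos (times_index mu) t).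
Proof. apply is_derive_zsin; [apply prob_abs_sum|apply first_moment_abs_sum]. Qed.

(** The modulus bound is [fourier_sqr_lower] after taking a square root.  The
    others come from the second moment: the first derivative vanishes at 0
    because the measure is centered, so integrating the bound on the second
    derivative twice gives the orders [t] and [t^2]. *)
Lemma fourier_estimates :
  exists c L, 0 < c /\ 0 < L /\ forall t, - PI <= t <= PI ->
    Cmod (fourier mu t) <= 1 - c * t ^ 2 /\
    Cmod (1 - fourier mu t)%C <= L * t ^ 2 /\
    Cmod (dfourier t) <= L * Rabs t /\
    Cmod (ddfourier t) <= L.
Proof.
  destruct fourier_sqr_lower as (c & Hc & Hlow).
  set (K := Zsum (fun k => Rabs (times_index (times_index mu) k))).
  assert (HK : 0 <= K).
  { eapply Rle_trans; [apply Rabs_pos|]. exact (zcos_abs_le _ second_moment_abs_sum 0). }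
  assert (HS : forall t, Rabs (zsin (times_index mu) t) <= K * Rabs t).
  { intro t. assert (E : zsin (times_index mu) 0 = 0).
    { pose proof (zsin_opp (times_index mu) 0) as E. rewrite Ropp_0 in E. lra. }
    rewrite <- (Rminus_0_r (zsin (times_index mu) t)), <- E.
    apply (Rabs_diff_le_derive _ (zcos (times_index (times_index mu)))).
    - intro u. apply (is_derive_zsin _ first_moment_abs_sum second_moment_abs_sum).
    - intros u _. apply zcos_abs_le, second_moment_abs_sum. }
  assert (HC : forall t, Rabs (zcos (times_index mu) t) <= K * Rabs t).
  { intro t. assert (E : zcos (times_index mu) 0 = 0).
    { apply is_Zsum_unique. eapply is_Zsum_ext; [|exact mu_cent].
      intro k; simpl. rewrite Rmult_0_r, cos_0. unfold times_index; ring. }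
    rewrite <- (Rminus_0_r (zcos (times_index mu) t)), <- E.
    apply (Rabs_diff_le_derive _ (fun u => - zsin (times_index (times_index mu)) u)).
    - intro u. apply (is_derive_zcos _ first_moment_abs_sum second_moment_abs_sum).
    - intros u _. rewrite Rabs_Ropp. apply zsin_abs_le, second_moment_abs_sum. }
  assert (Habs : forall t, Rabs t * Rabs t = t ^ 2) by (intro t; rewrite <- (pow2_abs t); ring).
  assert (HA : forall t, Rabs (1 - A t) <= K * t ^ 2).
  { intro t. assert (E : A 0 = 1).
    { apply is_Zsum_unique. eapply is_Zsum_ext; [|exact mu_one].
      intro k; simpl. rewrite Rmult_0_r, cos_0. ring. }
    rewrite Rabs_minus_sym, <- E, <- Habs, <- Rmult_assoc.
    apply (Rabs_diff_le_derive _ (fun u => - zsin (times_index mu) u)); auto.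
    intros u Hu. rewrite Rabs_Ropp. eapply Rle_trans; [apply HS|]. apply Rmult_le_compat_l; auto. }
  assert (HB : forall t, Rabs (B t) <= K * t ^ 2).
  { intro t. assert (E : B 0 = 0).
    { pose proof (zsin_opp mu 0) as E. rewrite Ropp_0 in E. unfold B. lra. }
    rewrite <- (Rminus_0_r (B t)), <- E, <- Habs, <- Rmult_assoc.
    apply (Rabs_diff_le_derive _ (zcos (times_index mu))); auto.
    intros u Hu. eapply Rle_trans; [apply HC|]. apply Rmult_le_compat_l; auto. }
  exists (c/2), (2 * K + 1). split; [lra|]. split; [lra|].
  intros t Ht. split; [|split; [|split]].
  - assert (Hl : c * t ^ 2 <= 1 - (zcos mu t ^ 2 + zsin mu t ^ 2)).
    { destruct (Rtotal_order t 0) as [H|[H|H]].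
      - specialize (Hlow (- t) ltac:(lra)). rewrite zcos_opp, zsin_opp in Hlow. nra.
      - subst t. pose proof (fourier_sqr_le_1 0). nra.
      - apply Hlow; lra. }
    rewrite fourier_eq. pose proof (Cmod_sqr (zcos mu t, zsin mu t)) as E.
    simpl fst in E; simpl snd in E. rewrite <- E in Hl.
    pose proof (pow2_ge_0 (Cmod (zcos mu t, zsin mu t) - 1)). lra.
  - rewrite fourier_eq.
    replace (1 - (zcos mu t, zsin mu t))%C with ((1 - A t, - B t) : C)
      by (unfold Cminus, Cplus, Copp, RtoC; simpl; f_equal; unfold A, B; ring).
    eapply Rle_trans; [apply Cmod_le_components|]. rewrite Rabs_Ropp.
    specialize (HA t); specialize (HB t). nra.
  - eapply Rle_trans; [apply Cmod_le_components|]. rewrite Rabs_Ropp.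
    specialize (HS t); specialize (HC t). pose proof (Rabs_pos t). nra.
  - eapply Rle_trans; [apply Cmod_le_components|]. rewrite !Rabs_Ropp.
    pose proof (zcos_abs_le _ second_moment_abs_sum t) as H1.
    pose proof (zsin_abs_le _ second_moment_abs_sum t) as H2. fold K in H1, H2. lra.
Qed.
End CharFun.

(** * Hypothesis (H) *)

Lemma is_derive_is_derive_within {V : NormedModule R_AbsRing}
    (D : R -> Prop) (f : R -> V) (x : R) (l : V) :
  D x -> is_derive f x l -> is_derive_within D f x l.
Proof.
  intros Dx H.
  assert (PF : ProperFilter (within D (locally x))).
  { constructor; [|apply within_filter, locally_filter].
    intros P HP. exists x. apply (locally_singleton x _ HP Dx). }
  refine (filterdiff_locally f x _ _ H).
  intros P HP. apply (filter_le_within D P HP).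
Qed.

Lemma continuous_continuous_within {V : NormedModule R_AbsRing}
    (D : R -> Prop) (f : R -> V) (x : R) :
  continuous f x -> continuous_within D f x.
Proof. intro H. eapply filterlim_filter_le_1; [apply filter_le_within|exact H]. Qed.

(** Writing a plane-valued function over this fixed real basis reduces its
    continuity and differentiability to those of its components. *)
Lemma C_components (z : C) :
  z = plus (scal (fst z) ((1, 0) : C_R_NormedModule)) (scal (snd z) ((0, 1) : C_R_NormedModule)).
Proof.
  destruct z as [a b]. unfold plus, scal; simpl. unfold prod_plus, prod_scal; simpl.
  unfold scal, plus; simpl. unfold mult; simpl. f_equal; ring.
Qed.

Lemma is_derive_C (a b : R -> R) (x da db : R) :
  is_derive a x da -> is_derive b x db ->
  is_derive (V := C_R_NormedModule) (fun t => (a t, b t)) x ((da, db) : C).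
Proof.
  intros Ha Hb. rewrite (C_components (da, db)).
  eapply (is_derive_ext (V := C_R_NormedModule)).
  { intro t. symmetry. apply (C_components (a t, b t)). }
  apply (is_derive_plus (V := C_R_NormedModule)); simpl;
    apply (is_derive_scal_l (V := C_R_NormedModule)); auto.
Qed.

Lemma continuous_C (a b : R -> R) (x : R) :
  continuous a x -> continuous b x ->
  continuous (U := C_R_NormedModule) (fun t => (a t, b t) : C) x.
Proof.
  intros Ha Hb.
  eapply (continuous_ext (U := C_R_NormedModule)).
  { intro t. symmetry. apply (C_components (a t, b t)). }
  apply (continuous_plus (V := C_R_NormedModule)); simpl;
    apply (continuous_scal_l (V := C_R_NormedModule)); auto.
Qed.

(** The witness is [psi t = t ^ 2]: each bound of the hypothesis is then one of
    [fourier_estimates]. *)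
Lemma hypothesis_H_of_moments (mu : Z -> R)
  (mu_prob : is_probability mu)
  (mu_aper : strictly_aperiodic mu)
  (mu_mom2 : ex_Zsum (fun k : Z => (IZR k) ^ 2 * mu k))
  (mu_cent : is_Zsum (fun k : Z => IZR k * mu k) 0) :
  hypothesis_H mu.
Proof.
  destruct (fourier_estimates mu mu_prob mu_aper mu_mom2 mu_cent) as (c & L & Hc & HL & Hest).
  pose proof (prob_abs_sum mu mu_prob) as S0.
  pose proof (first_moment_abs_sum mu mu_prob mu_mom2) as S1.
  pose proof (second_moment_abs_sum mu mu_prob mu_mom2) as S2.
  exists (dfourier mu), (ddfourier mu). split; [|split].
  - intros x Dx. split.
    + apply is_derive_is_derive_within; auto.
      eapply (is_derive_ext (V := C_R_NormedModule)); [intro t; symmetry; apply fourier_eq|].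
      apply is_derive_C; [apply is_derive_zcos|apply is_derive_zsin]; auto.
    + apply continuous_continuous_within, continuous_C.
      * apply (continuous_opp (V := R_NormedModule)), continuous_zsin; auto.
      * apply continuous_zcos; auto.
  - intros x Dx. split.
    + apply is_derive_is_derive_within; auto. apply is_derive_C.
      * apply (is_derive_opp (V := R_NormedModule)), is_derive_zsin; auto.
      * apply is_derive_zcos; auto.
    + apply continuous_continuous_within, continuous_C;
        apply (continuous_opp (V := R_NormedModule));
        [apply continuous_zcos|apply continuous_zsin]; auto.
  - assert (HD : forall x, is_derive (fun t : R => t ^ 2) x (2 * x))
      by (intro x; auto_derive; auto; ring).
    exists (fun t => t ^ 2), (fun t => 2 * t), c, L.
    split; [|split; [|split; [|split; [|split; [|split]]]]]; auto.
    + intros x _; ring.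
    + intros x _. apply (continuous_continuous_within (V := R_NormedModule)).
      apply (continuous_of_is_derive _ (fun t => 2 * t)); auto.
    + simpl; ring.
    + intros x Dx. split.
      * apply is_derive_is_derive_within; auto.
      * apply (continuous_continuous_within (V := R_NormedModule)).
        apply (continuous_of_is_derive _ (fun _ => 2)). auto_derive; auto; ring.
    + intros t Ht. destruct (Hest t ltac:(lra)) as (H1 & _ & H3 & H4).
      rewrite !Cmod_mult, !Cmod_R. rewrite (Rabs_pos_eq t) in * by lra.
      repeat split; auto; nra.
Qed.

(** * Fourier coefficients of plane-valued functions *)

Lemma continuous_Rplus (f g : R -> R) x :
  continuous f x -> continuous g x -> continuous (fun t => f t + g t) x.
Proof. apply (continuous_plus (V := R_NormedModule)). Qed.

Lemma continuous_Rmult (f g : R -> R) x :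
  continuous f x -> continuous g x -> continuous (fun t => f t * g t) x.
Proof. apply (continuous_mult (K := R_AbsRing)). Qed.

Lemma continuous_Ropp (f : R -> R) x : continuous f x -> continuous (fun t => - f t) x.
Proof. apply (continuous_opp (V := R_NormedModule)). Qed.

Lemma continuous_Rminus (f g : R -> R) x :
  continuous f x -> continuous g x -> continuous (fun t => f t - g t) x.
Proof. apply (continuous_minus (V := R_NormedModule)). Qed.

Lemma continuous_Rpow (f : R -> R) n x : continuous f x -> continuous (fun t => f t ^ n) x.
Proof.
  intro H. induction n as [|n IH]; simpl; [apply continuous_const|].
  apply continuous_Rmult; auto.
Qed.

Lemma continuous_cos_lin a x : continuous (fun t => cos (a * t)) x.
Proof. apply (continuous_of_is_derive _ (fun t => - a * sin (a * t))). auto_derive; auto; ring. Qed.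

Lemma continuous_sin_lin a x : continuous (fun t => sin (a * t)) x.
Proof. apply (continuous_of_is_derive _ (fun t => a * cos (a * t))). auto_derive; auto; ring. Qed.

Create HintDb cont.
#[local] Hint Resolve continuous_Rplus continuous_Rmult continuous_Ropp continuous_Rminus
  continuous_Rpow continuous_cos_lin continuous_sin_lin continuous_const : cont.
Ltac cont := cbv beta; auto 20 with cont.

Definition cts (f : R -> R) := forall x, continuous f x.
Definition ctsC (W : R -> C) := cts (fun t => fst (W t)) /\ cts (fun t => snd (W t)).

Lemma ex_RInt_cts f a b : cts f -> ex_RInt f a b.
Proof. intro H. apply (ex_RInt_continuous (V := R_CompleteNormedModule)); auto. Qed.

Lemma RInt_axpy (f g : R -> R) a u v : cts f -> cts g ->
  RInt (fun t => f t + a * g t) u v = RInt f u v + a * RInt g u v.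
Proof.
  intros Hf Hg.
  rewrite (RInt_plus (V := R_CompleteNormedModule) f (fun t => scal a (g t))).
  - rewrite (RInt_scal (V := R_CompleteNormedModule)); [reflexivity|apply ex_RInt_cts; auto].
  - apply ex_RInt_cts; auto.
  - apply ex_RInt_cts. unfold scal; simpl; unfold mult; simpl. intro x; cont.
Qed.

Lemma RInt_scalR (f : R -> R) a u v : cts f -> RInt (fun t => a * f t) u v = a * RInt f u v.
Proof.
  intro Hf. apply (RInt_scal (V := R_CompleteNormedModule)). apply ex_RInt_cts; auto.
Qed.

Lemma RInt_extR (f g : R -> R) u v : (forall t, f t = g t) -> RInt f u v = RInt g u v.
Proof. intro E. apply RInt_ext; auto. Qed.

(** The real part of the [k]-th Fourier coefficient of [W]: the real inner
    product of [W] with the plane-valued function [cis (k t)], normalised so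
    that these functions are orthonormal over [k : Z].  Since the coefficients
    of interest are real, this real inner product space suffices. *)
Definition coef (W : R -> C) (k : Z) : R :=
  / (2 * PI) * RInt (fun t => fst (W t) * cos (IZR k * t) + snd (W t) * sin (IZR k * t)) (- PI) PI.

(** The squared norm for the inner product that defines [coef]. *)
Definition energy (W : R -> C) : R :=
  / (2 * PI) * RInt (fun t => fst (W t) ^ 2 + snd (W t) ^ 2) (- PI) PI.

Lemma RInt_cos_period (k : Z) :
  RInt (fun t => cos (IZR k * t)) (- PI) PI = if Z.eq_dec k 0 then 2 * PI else 0.
Proof.
  destruct (Z.eq_dec k 0) as [->|Hk].
  - rewrite (RInt_extR _ (fun _ => 1)).
    + rewrite RInt_const. unfold scal; simpl; unfold mult; simpl. ring.
    + intro t. rewrite Rmult_0_l. apply cos_0.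
  - assert (Hk' : IZR k <> 0) by (apply not_0_IZR; auto).
    apply is_RInt_unique.
    replace 0 with (minus (/ IZR k * sin (IZR k * PI)) (/ IZR k * sin (IZR k * (- PI)))).
    + apply (is_RInt_derive (V := R_CompleteNormedModule) (fun t => / IZR k * sin (IZR k * t))).
      * intros x _. auto_derive; auto. field; auto.
      * intros x _. cont.
    + rewrite (sin_eq_0_1 (IZR k * PI)) by eauto.
      replace (IZR k * - PI) with (IZR (- k) * PI) by (rewrite opp_IZR; ring).
      rewrite (sin_eq_0_1 (IZR (- k) * PI)) by eauto.
      unfold minus, plus, opp; simpl; ring.
Qed.

Lemma cts_coef W k : ctsC W ->
  cts (fun t => fst (W t) * cos (IZR k * t) + snd (W t) * sin (IZR k * t)).
Proof. intros [H1 H2] x. cont. Qed.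

Definition proj_out (W : R -> C) (a : R) (k : Z) (t : R) : C :=
  (fst (W t) - a * cos (IZR k * t), snd (W t) - a * sin (IZR k * t)).

Lemma ctsC_proj_out W a k : ctsC W -> ctsC (proj_out W a k).
Proof. intros [H1 H2]; split; intro x; simpl; cont. Qed.

Lemma coef_proj_out W a k j : ctsC W ->
  coef (proj_out W a k) j = coef W j - a * (if Z.eq_dec j k then 1 else 0).
Proof.
  intros HW. unfold coef, proj_out; simpl.
  rewrite (RInt_extR _ (fun t => (fst (W t) * cos (IZR j * t) + snd (W t) * sin (IZR j * t))
    + (- a) * cos (IZR (j - k) * t))).
  - rewrite RInt_axpy; [|apply cts_coef; auto|intro; cont].
    rewrite RInt_cos_period. pose proof PI_RGT_0.
    destruct (Z.eq_dec j k), (Z.eq_dec (j - k) 0); try lia; field; lra.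
  - intro t. replace (IZR (j - k) * t) with (IZR j * t - IZR k * t) by (rewrite minus_IZR; ring).
    rewrite cos_minus. ring.
Qed.

Lemma energy_proj_out W a k : ctsC W ->
  energy (proj_out W a k) = energy W - 2 * a * coef W k + a ^ 2.
Proof.
  intros HW. destruct (HW) as [H1 H2]. unfold energy, coef, proj_out; simpl fst; simpl snd.
  rewrite (RInt_extR _ (fun t => (fst (W t) ^ 2 + snd (W t) ^ 2
    + (- 2 * a) * (fst (W t) * cos (IZR k * t) + snd (W t) * sin (IZR k * t))) + a ^ 2 * 1)).
  - rewrite (RInt_axpy (fun t => fst (W t) ^ 2 + snd (W t) ^ 2
      + (- 2 * a) * (fst (W t) * cos (IZR k * t) + snd (W t) * sin (IZR k * t))) (fun _ => 1));
      [|intro; cont|intro; cont].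
    rewrite (RInt_axpy (fun t => fst (W t) ^ 2 + snd (W t) ^ 2)); [|intro; cont|intro; cont].
    rewrite RInt_const. unfold scal; simpl; unfold mult; simpl.
    pose proof PI_RGT_0. field; lra.
  - intro t. pose proof (sin2_cos2 (IZR k * t)) as E. unfold Rsqr in E.
    replace (a ^ 2 * 1) with (a ^ 2 * (sin (IZR k * t) * sin (IZR k * t)
      + cos (IZR k * t) * cos (IZR k * t))) by (rewrite E; ring). ring.
Qed.

Lemma RInt_nonneg f : cts f -> (forall t, 0 <= f t) -> 0 <= RInt f (- PI) PI.
Proof.
  intros Hf H. pose proof PI_RGT_0. apply RInt_ge_0; [lra|apply ex_RInt_cts; auto|auto].
Qed.

Lemma energy_nonneg W : ctsC W -> 0 <= energy W.
Proof.
  intros [H1 H2]. pose proof PI_RGT_0. apply Rmult_le_pos.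
  - apply Rlt_le, Rinv_0_lt_compat; lra.
  - apply RInt_nonneg; [intro; cont|]. intro t. 
    apply Rplus_le_le_0_compat; apply pow2_ge_0.
Qed.

Fixpoint residual (W : R -> C) (e : nat -> Z) (n : nat) : R -> C :=
  match n with
  | O => W
  | S m => proj_out (residual W e m) (coef W (e m)) (e m)
  end.

(** Removing one exponential lowers the energy by the square of its coefficient
    and leaves the other coefficients unchanged, while energies stay
    nonnegative. *)
Lemma bessel W (e : nat -> Z) : ctsC W -> (forall m n, e m = e n -> m = n) ->
  forall n, sum_n (fun m => coef W (e m) ^ 2) n <= energy W.
Proof.
  intros HW He.
  assert (HC : forall n, ctsC (residual W e n))
    by (induction n; simpl; auto using ctsC_proj_out).
  assert (Hcoef : forall n m, (n <= m)%nat -> coef (residual W e n) (e m) = coef W (e m)).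
  { induction n as [|n IH]; intros m Hm; simpl; auto.
    rewrite coef_proj_out; auto. rewrite IH by lia.
    destruct (Z.eq_dec (e m) (e n)) as [E|_]; [apply He in E; lia|ring]. }
  assert (Hen : forall n, energy (residual W e (S n)) = energy W - sum_n (fun m => coef W (e m) ^ 2) n).
  { induction n as [|n IH].
    - simpl. rewrite sum_O, energy_proj_out by auto. ring.
    - rewrite sum_Sn. change (residual W e (S (S n))) with
        (proj_out (residual W e (S n)) (coef W (e (S n))) (e (S n))).
      rewrite energy_proj_out, IH, Hcoef by auto. unfold plus; simpl; ring. }
  intro n. pose proof (energy_nonneg _ (HC (S n))) as H. rewrite Hen in H. lra.
Qed.

Lemma is_derive_rotated (u v : R -> R) (du dv a t : R) :
  is_derive u t du -> is_derive v t dv ->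
  is_derive (fun t => v t * cos (a * t) - u t * sin (a * t)) t
    (dv * cos (a * t) + - du * sin (a * t) + - a * (u t * cos (a * t) + v t * sin (a * t))).
Proof.
  intros Hu Hv. auto_derive.
  - split; [eexists; apply Hv|]. split; [eexists; apply Hu|auto].
  - replace (Derive (fun x => u x) t) with du by (symmetry; apply is_derive_unique; auto).
    replace (Derive (fun x => v x) t) with dv by (symmetry; apply is_derive_unique; auto).
    ring.
Qed.

(** Integration by parts; the right-hand function is [- i dW]. *)
Lemma coef_derive W dW k :
  ctsC W -> ctsC dW ->
  (forall t, is_derive (fun t => fst (W t)) t (fst (dW t))) ->
  (forall t, is_derive (fun t => snd (W t)) t (snd (dW t))) ->
  W (- PI) = W PI ->
  IZR k * coef W k = coef (fun t => (snd (dW t), - fst (dW t)) : C) k.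
Proof.
  intros HW HdW D1 D2 Hper. destruct (HW) as [H1 H2]; destruct (HdW) as [H3 H4].
  unfold coef; simpl fst; simpl snd.
  set (I1 := RInt _ _ _). set (I2 := RInt _ _ _).
  assert (E : I2 + (- IZR k) * I1 = 0).
  2: { replace I2 with (IZR k * I1) by lra. ring. }
  unfold I1, I2. rewrite <- RInt_axpy; [|intro; cont|intro; cont].
  set (G := fun t => snd (W t) * cos (IZR k * t) - fst (W t) * sin (IZR k * t)).
  apply is_RInt_unique.
  replace 0 with (minus (G PI) (G (- PI))).
  - apply (is_RInt_derive (V := R_CompleteNormedModule) G).
    + intros t _. apply (is_derive_rotated (fun t => fst (W t)) (fun t => snd (W t))); auto.
    + intros t _. cont.
  - unfold G. rewrite Hper. rewrite (sin_eq_0_1 (IZR k * PI)) by eauto.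
    replace (IZR k * - PI) with (- (IZR k * PI)) by ring.
    rewrite cos_neg, sin_neg, (sin_eq_0_1 (IZR k * PI)) by eauto.
    unfold minus, plus, opp; simpl; ring.
Qed.

(** Telescoping: with [x = s + n + 1] one has
    [1 / (s^2 + (n + 1)^2) <= 2 / x^2 <= 2 / (x - 1) - 2 / x]. *)
Lemma inverse_square_sum (s : R) n : 1 <= s ->
  sum_n (fun m => / (s ^ 2 + INR m ^ 2)) n <= 3 / s - 2 / (s + INR n).
Proof.
  intro Hs. induction n as [|n IH].
  - rewrite sum_O. simpl INR. replace (3 / s - 2 / (s + 0)) with (/ s) by (field; lra).
    apply Rinv_le_contravar; nra.
  - rewrite sum_Sn. unfold plus; simpl plus. eapply Rle_trans; [apply Rplus_le_compat_r, IH|].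
    pose proof (pos_INR n) as Hn. rewrite S_INR. set (x := INR n) in *.
    assert (/ (s ^ 2 + (x + 1) ^ 2) <= 2 / (s + x) - 2 / (s + (x + 1))); [|lra].
    replace (2 / (s + x) - 2 / (s + (x + 1))) with (/ ((s + x) * (s + x + 1) / 2))
      by (field; lra).
    apply Rinv_le_contravar; [nra|]. pose proof (pow2_ge_0 (s - (x + 1))). nra.
Qed.

(** A Bernstein-type bound of the absolute sum of the coefficients by the
    energies of [W] and of its derivative.  Weighted by [p = s^2 + k^2], the
    arithmetic-geometric inequality gives
    [2 |a_k| <= 1 / (s p) + s p a_k^2]; summing the first terms is elementary,
    and Bessel's inequality for [W] and for its derivative sums [a_k^2] and
    [k^2 a_k^2].  With [s = sqrt N] and the powers of [s] assumed on the
    energies, both parts are of order [1 / N]. *)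
Lemma coef_abs_sum_le W dW (e : nat -> Z) (s K : R) :
  ctsC W -> ctsC dW ->
  (forall t, is_derive (fun t => fst (W t)) t (fst (dW t))) ->
  (forall t, is_derive (fun t => snd (W t)) t (snd (dW t))) ->
  W (- PI) = W PI ->
  (forall m n, e m = e n -> m = n) -> (forall n, INR n ^ 2 <= IZR (e n) ^ 2) ->
  1 <= s -> energy W <= K / s ^ 5 -> energy dW <= K / s ^ 3 ->
  forall n, sum_n (fun m => Rabs (coef W (e m))) n <= (3 / 2 + K) / s ^ 2.
Proof.
  intros HW HdW D1 D2 Hper He Hen Hs E0 E1 n.
  set (a := fun m => coef W (e m)).
  set (b := fun m => coef (fun t => (snd (dW t), - fst (dW t)) : C) (e m)).
  assert (Hb : forall m, IZR (e m) * a m = b m) by (intro m; exact (coef_derive W dW (e m) HW HdW D1 D2 Hper)).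
  assert (HdW' : ctsC (fun t => (snd (dW t), - fst (dW t)) : C)).
  { destruct HdW; split; intro x; simpl; cont. }
  assert (E1' : energy (fun t => (snd (dW t), - fst (dW t)) : C) = energy dW).
  { unfold energy; simpl fst; simpl snd. f_equal. apply RInt_extR. intro t; ring. }
  pose proof (bessel W e HW He n) as B0.
  pose proof (bessel _ e HdW' He n) as B1. rewrite E1' in B1.
  pose proof (inverse_square_sum s n Hs) as B2.
  assert (Hpt : forall m, Rabs (a m) <=
    / (2 * s) * / (s ^ 2 + INR m ^ 2) + (s ^ 3 / 2 * a m ^ 2 + s / 2 * b m ^ 2)).
  { intro m. rewrite <- Hb. set (q := IZR (e m)). set (p := s ^ 2 + INR m ^ 2).
    assert (Hp : 0 < p) by (unfold p; pose proof (pow2_ge_0 (INR m)); nra).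
    assert (Hpq : p <= s ^ 2 + q ^ 2) by (unfold p, q; specialize (Hen m); lra).
    apply Rle_trans with (/ (2 * s) * / p + s / 2 * p * a m ^ 2).
    - assert (E : / (2 * s) * / p + s / 2 * p * a m ^ 2 - Rabs (a m)
        = s * p / 2 * (Rabs (a m) - / (s * p)) ^ 2).
      { rewrite <- (pow2_abs (a m)). field. split; lra. }
      assert (0 <= s * p / 2 * (Rabs (a m) - / (s * p)) ^ 2).
      { apply Rmult_le_pos; [|apply pow2_ge_0]. nra. }
      lra.
    - apply Rplus_le_compat_l.
      replace (s ^ 3 / 2 * a m ^ 2 + s / 2 * (q * a m) ^ 2)
        with (s / 2 * (s ^ 2 + q ^ 2) * a m ^ 2) by field.
      apply Rmult_le_compat_r; [apply pow2_ge_0|]. apply Rmult_le_compat_l; lra. }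
  apply Rle_trans with (sum_n (fun m =>
    / (2 * s) * / (s ^ 2 + INR m ^ 2) + (s ^ 3 / 2 * a m ^ 2 + s / 2 * b m ^ 2)) n).
  { rewrite !sum_n_Reals. apply sum_Rle. intros m _. apply Hpt. }
  apply Rle_trans with (/ (2 * s) * (3 / s) + (s ^ 3 / 2 * (K / s ^ 5) + s / 2 * (K / s ^ 3))).
  - assert (E : forall f g h : nat -> R, forall x y z : R,
      sum_n (fun m => x * f m + (y * g m + z * h m)) n
      = x * sum_n f n + (y * sum_n g n + z * sum_n h n)).
    { intros. rewrite !sum_n_Reals. clear. induction n as [|n IH]; simpl; [ring|].
      rewrite IH; ring. }
    rewrite E.
    assert (0 < / (2 * s)) by (apply Rinv_0_lt_compat; lra).
    assert (0 < s ^ 3 / 2) by (assert (0 < s ^ 3) by (apply pow_lt; lra); lra).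
    assert (0 <= 2 / (s + INR n)).
    { apply Rlt_le, Rdiv_lt_0_compat; [lra|]. pose proof (pos_INR n); lra. }
    apply Rplus_le_compat; [|apply Rplus_le_compat]; apply Rmult_le_compat_l; try lra.
    + unfold a. lra.
    + unfold b. lra.
  - apply Req_le. field. lra.
Qed.

(** * The Ritt property *)

Lemma is_series_bounded (u : nat -> R) (M : R) :
  (forall n, 0 <= u n) -> (forall n, sum_n u n <= M) -> exists l, is_series u l /\ l <= M.
Proof.
  intros Hu HM.
  destruct (ex_finite_lim_seq_incr (sum_n u) M) as [l Hl]; auto.
  - intro n. rewrite sum_Sn. unfold plus; simpl. specialize (Hu (S n)); lra.
  - exists l. split; [exact Hl|].
    apply (is_lim_seq_le (sum_n u) (fun _ => M) l M); auto. apply is_lim_seq_const.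
Qed.

(** Componentwise form, which makes the real calculus lemmas applicable. *)
Definition is_deriveC (f : R -> C) (t : R) (l : C) : Prop :=
  is_derive (fun t => fst (f t)) t (fst l) /\ is_derive (fun t => snd (f t)) t (snd l).

Lemma is_deriveC_minus f g t df dg :
  is_deriveC f t df -> is_deriveC g t dg -> is_deriveC (fun t => f t - g t)%C t (df - dg)%C.
Proof.
  intros [F1 F2] [G1 G2]; split.
  - apply (is_derive_minus (V := R_NormedModule) _ _ _ _ _ F1 G1).
  - apply (is_derive_minus (V := R_NormedModule) _ _ _ _ _ F2 G2).
Qed.

Lemma is_deriveC_mult f g t df dg :
  is_deriveC f t df -> is_deriveC g t dg ->
  is_deriveC (fun t => f t * g t)%C t (df * g t + f t * dg)%C.
Proof.
  intros [F1 F2] [G1 G2].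
  pose proof (is_derive_mult (K := R_AbsRing) _ _ _ _ _ F1 G1 Rmult_comm) as H11.
  pose proof (is_derive_mult (K := R_AbsRing) _ _ _ _ _ F1 G2 Rmult_comm) as H12.
  pose proof (is_derive_mult (K := R_AbsRing) _ _ _ _ _ F2 G1 Rmult_comm) as H21.
  pose proof (is_derive_mult (K := R_AbsRing) _ _ _ _ _ F2 G2 Rmult_comm) as H22.
  split.
  - pose proof (is_derive_minus (V := R_NormedModule) _ _ _ _ _ H11 H22) as H.
    match type of H with is_derive _ _ ?l => replace (fst _) with l; [exact H|] end.
    unfold minus, plus, opp, mult; simpl. ring.
  - pose proof (is_derive_plus (V := R_NormedModule) _ _ _ _ _ H12 H21) as H.
    match type of H with is_derive _ _ ?l => replace (snd _) with l; [exact H|] end.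
    unfold minus, plus, opp, mult; simpl. ring.
Qed.

Lemma is_deriveC_pow f t df m : is_deriveC f t df ->
  is_deriveC (fun t => f t ^ S m)%C t (RtoC (INR (S m)) * f t ^ m * df)%C.
Proof.
  intro H. induction m as [|m IH].
  - assert (E : (RtoC (INR 1) * f t ^ 0 * df)%C = df) by (simpl; ring).
    rewrite E. destruct H as [H1 H2]; split;
      (eapply is_derive_ext; [|eassumption]); intro u; cbv beta; rewrite Cpow_1_r; reflexivity.
  - pose proof (is_deriveC_mult _ _ _ _ _ H IH) as HM.
    assert (E : (RtoC (INR (S (S m))) * f t ^ S m * df)%C
      = (df * f t ^ S m + f t * (RtoC (INR (S m)) * f t ^ m * df))%C).
    { rewrite (S_INR (S m)), RtoC_plus, !Cpow_S. ring. }
    rewrite E. exact HM.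
Qed.

Lemma ctsC_mult f g : ctsC f -> ctsC g -> ctsC (fun t => f t * g t)%C.
Proof. intros [? ?] [? ?]; split; intro x; simpl; cont. Qed.

Lemma ctsC_minus f g : ctsC f -> ctsC g -> ctsC (fun t => f t - g t)%C.
Proof.
  intros [? ?] [? ?]; split; intro x; simpl; cont;
  apply continuous_Rplus; auto; apply continuous_Ropp; auto.
Qed.

Lemma ctsC_const c : ctsC (fun _ => c).
Proof. split; intro x; cont. Qed.

Lemma ctsC_pow f n : ctsC f -> ctsC (fun t => f t ^ n)%C.
Proof.
  intro H. induction n as [|n IH]; simpl; [apply ctsC_const|apply ctsC_mult; auto].
Qed.

(** The antiderivative is [atan (b t) / b], and [atan] varies by less than [PI]. *)
Lemma RInt_cauchy_density_le b : 0 < b ->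
  RInt (fun t => / (1 + (b * t) ^ 2)) (- PI) PI <= PI / b.
Proof.
  intro Hb. pose proof PI_RGT_0.
  assert (HI : is_RInt (fun t => / (1 + (b * t) ^ 2)) (- PI) PI
    (minus (/ b * atan (b * PI)) (/ b * atan (b * - PI)))).
  { apply (is_RInt_derive (V := R_CompleteNormedModule) (fun t => / b * atan (b * t))).
    - intros t _. auto_derive; auto. unfold Rsqr. field.
      split; [|lra]. pose proof (pow2_ge_0 (b * t)). nra.
    - intros t _. apply (continuous_of_is_derive _
        (fun t => - (2 * b ^ 2 * t) / (1 + (b * t) ^ 2) ^ 2)).
      pose proof (pow2_ge_0 (b * t)).
      auto_derive; [nra|]. field. nra. }
  rewrite (is_RInt_unique _ _ _ _ HI). unfold minus, plus, opp; simpl.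
  pose proof (atan_bound (b * PI)); pose proof (atan_bound (b * - PI)).
  assert (0 < / b) by (apply Rinv_0_lt_compat; auto).
  unfold Rdiv. rewrite (Rmult_comm PI). nra.
Qed.

Lemma energy_le W G b : ctsC W -> 0 < b ->
  (forall t, - PI <= t <= PI -> Cmod (W t) ^ 2 <= G * / (1 + (b * t) ^ 2)) ->
  energy W <= G / (2 * b).
Proof.
  intros [H1 H2] Hb HG. pose proof PI_RGT_0.
  assert (HG0 : 0 <= G).
  { pose proof (HG 0 ltac:(lra)) as H0. pose proof (pow2_ge_0 (Cmod (W 0))).
    replace (/ (1 + (b * 0) ^ 2)) with 1 in H0 by field. lra. }
  assert (Hc : cts (fun t => / (1 + (b * t) ^ 2))).
  { intro t. apply (continuous_of_is_derive _
        (fun t => - (2 * b ^ 2 * t) / (1 + (b * t) ^ 2) ^ 2)).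
      pose proof (pow2_ge_0 (b * t)).
      auto_derive; [nra|]. field. nra. }
  unfold energy.
  apply Rle_trans with (/ (2 * PI) * (G * (PI / b))).
  2: { apply Req_le. field. lra. }
  apply Rmult_le_compat_l; [apply Rlt_le, Rinv_0_lt_compat; lra|].
  apply Rle_trans with (G * RInt (fun t => / (1 + (b * t) ^ 2)) (- PI) PI).
  2: { apply Rmult_le_compat_l; auto. apply RInt_cauchy_density_le; auto. }
  rewrite <- RInt_scalR by auto.
  apply RInt_le; [lra| | |].
  - apply ex_RInt_cts. intro; cont.
  - apply ex_RInt_cts. intro; cont.
  - intros t Ht. rewrite <- Cmod_sqr. apply HG. lra.
Qed.

Section ConvPow.
Variable mu : Z -> R.
Hypothesis mu_prob : is_probability mu.

Lemma ctsC_fourier : ctsC (fourier mu).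
Proof.
  pose proof (prob_abs_sum mu mu_prob) as S0. split; intro x.
  - apply (continuous_ext (zcos mu)); [intro t; now rewrite fourier_eq|].
    apply continuous_zcos; auto.
  - apply (continuous_ext (zsin mu)); [intro t; now rewrite fourier_eq|].
    apply continuous_zsin; auto.
Qed.

Lemma Cmod_fourier_le_1 t : Cmod (fourier mu t) <= 1.
Proof.
  pose proof (fourier_sqr_le_1 mu mu_prob t) as H. rewrite fourier_eq.
  pose proof (Cmod_sqr (zcos mu t, zsin mu t)) as E; simpl fst in E; simpl snd in E.
  rewrite <- E in H. pose proof (Cmod_ge_0 (zcos mu t, zsin mu t)). nra.
Qed.

(** Multiplying a function by the transform of [mu] convolves its coefficients
    with [mu]: integrate the dominated series term by term. *)
Lemma conv_coef W k : ctsC W -> (forall t, Cmod (W t) <= 1) ->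
  conv mu (coef W) k = coef (fun t => fourier mu t * W t)%C k.
Proof.
  intros HW Hb. destruct (HW) as [H1 H2]. unfold conv. apply is_Zsum_unique.
  pose proof (prob_abs_sum mu mu_prob) as S0.
  set (F := fun j t => mu j * (fst (W t) * cos (IZR (k - j) * t) + snd (W t) * sin (IZR (k - j) * t))).
  assert (HF : forall j t, continuous (F j) t) by (intros; unfold F; cont).
  assert (HI : is_Zsum (fun j => RInt (F j) (- PI) PI)
    (RInt (fun t => Zsum (fun j => F j t)) (- PI) PI)).
  { apply (is_Zsum_RInt F (fun j => 2 * Rabs (mu j))); auto.
    - intros j t. unfold F. rewrite Rabs_mult, Rmult_comm.
      apply Rmult_le_compat_r; [apply Rabs_pos|].
      pose proof (Rmax_Cmod (W t)) as HM. specialize (Hb t).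
      pose proof (Rmax_l (Rabs (fst (W t))) (Rabs (snd (W t)))).
      pose proof (Rmax_r (Rabs (fst (W t))) (Rabs (snd (W t)))).
      eapply Rle_trans; [apply Rabs_triang|].
      pose proof (Rabs_mult_cos_le (fst (W t)) (IZR (k - j) * t)).
      pose proof (Rabs_mult_sin_le (snd (W t)) (IZR (k - j) * t)). lra.
    - destruct S0 as [l Hl]. exists (2 * l). apply is_Zsum_scal; auto. }
  unfold coef at 2.
  rewrite (RInt_extR _ (fun t => Zsum (fun j => F j t))).
  - eapply is_Zsum_ext; [|apply (is_Zsum_scal (/ (2 * PI)) _ _ HI)].
    intro j; unfold coef, F; simpl. rewrite RInt_scalR; [ring|apply cts_coef; auto].
  - intro t. symmetry. apply is_Zsum_unique. rewrite fourier_eq.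
    set (u := fst (W t)); set (v := snd (W t)).
    set (ck := cos (IZR k * t)); set (sk := sin (IZR k * t)).
    apply (is_Zsum_ext (fun j => (u * ck + v * sk) * (mu j * cos (IZR j * t))
      + (u * sk - v * ck) * (mu j * sin (IZR j * t)))).
    + intro j. unfold F. fold u v.
      replace (IZR (k - j) * t) with (IZR k * t - IZR j * t) by (rewrite minus_IZR; ring).
      rewrite cos_minus, sin_minus. fold ck sk. ring.
    + match goal with |- is_Zsum _ ?l => replace l with
        ((u * ck + v * sk) * zcos mu t + (u * sk - v * ck) * zsin mu t) end.
      * apply is_Zsum_plus; apply is_Zsum_scal; [apply is_Zsum_zcos|apply is_Zsum_zsin]; auto.
      * simpl. fold u v. ring.
Qed.

(** The inversion formula for convolution powers. *)
Lemma conv_pow_coef n : forall k, conv_pow mu n k = coef (fun t => fourier mu t ^ n)%C k.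
Proof.
  induction n as [|n IH]; intro k.
  - simpl. unfold coef, dirac0. simpl.
    rewrite (RInt_extR _ (fun t => cos (IZR k * t))) by (intro; ring).
    rewrite RInt_cos_period. pose proof PI_RGT_0.
    destruct (Z.eq_dec k 0); field; lra.
  - change (conv_pow mu (S n) k) with (conv mu (conv_pow mu n) k).
    transitivity (conv mu (coef (fun t => fourier mu t ^ n)%C) k).
    + unfold conv. apply Zsum_ext. intro j. now rewrite IH.
    + rewrite conv_coef.
      * reflexivity.
      * apply ctsC_pow, ctsC_fourier.
      * intro t. rewrite Cmod_pow. rewrite <- (pow1 n). apply pow_incr.
        split; [apply Cmod_ge_0|apply Cmod_fourier_le_1].
Qed.

Lemma coef_minus f g k : ctsC f -> ctsC g ->
  coef (fun t => f t - g t)%C k = coef f k - coef g k.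
Proof.
  intros Hf Hg. unfold coef.
  rewrite (RInt_extR _ (fun t => (fst (f t) * cos (IZR k * t) + snd (f t) * sin (IZR k * t)) +
    (-1) * (fst (g t) * cos (IZR k * t) + snd (g t) * sin (IZR k * t)))).
  - rewrite RInt_axpy by (apply cts_coef; auto). ring.
  - intro t; simpl; ring.
Qed.
End ConvPow.

(** Polynomial decay replaces Gaussian decay below; the exponent 4 is enough to
    absorb the powers of [x] that occur in [energy_pow_gap_le]. *)
Lemma exp_opp_le_inv_pow4 x : 0 <= x -> exp (- x) <= (/ (1 + x / 4)) ^ 4.
Proof.
  intro Hx.
  replace (- x) with (- (x / 4) + (- (x / 4) + (- (x / 4) + - (x / 4)))) by field.
  rewrite !exp_plus. simpl. rewrite Rmult_1_r.
  assert (H : exp (- (x / 4)) <= / (1 + x / 4)).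
  { rewrite exp_Ropp. apply Rinv_le_contravar; [lra|apply exp_ineq1_le]. }
  assert (H0 : 0 <= exp (- (x / 4))) by apply Rlt_le, exp_pos.
  repeat (apply Rmult_le_compat; auto; try (repeat apply Rmult_le_pos; auto)).
Qed.

(** Passing from the exponent [m] to [S m] costs a factor [exp x <= 3]. *)
Lemma pow_one_minus_le x m : 0 <= x <= 1 ->
  (1 - x) ^ m <= 3 * (/ (1 + INR (S m) * x / 4)) ^ 4.
Proof.
  intros [H0 H1]. pose proof (pos_INR (S m)).
  apply Rle_trans with (exp (- x) ^ m).
  { apply pow_incr. pose proof (exp_ineq1_le (- x)). lra. }
  assert (E : exp (- x) ^ m = exp x * exp (- (INR (S m) * x))).
  { rewrite <- exp_plus, S_INR. clear. induction m as [|m IH].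
    - simpl. replace (x + - ((0 + 1) * x)) with 0 by ring. now rewrite exp_0.
    - simpl pow. rewrite IH, <- exp_plus, S_INR. f_equal; ring. }
  rewrite E. apply Rmult_le_compat; try (apply Rlt_le, exp_pos).
  - eapply Rle_trans; [|apply exp_le_3]. destruct (Req_dec x 1) as [->|]; [lra|].
    apply Rlt_le, exp_increasing; lra.
  - apply exp_opp_le_inv_pow4. nra.
Qed.

Definition pow_gap (z : R -> C) (n : nat) (t : R) : C := (z t ^ n - z t ^ S n)%C.

(** The derivative of [pow_gap z (S m)] when [dz] is the derivative of [z]. *)
Definition dpow_gap (z dz : R -> C) (m : nat) (t : R) : C :=
  (RtoC (INR (S m)) * z t ^ m * dz t - RtoC (INR (S (S m))) * z t ^ S m * dz t)%C.

Lemma ctsC_pow_gap z n : ctsC z -> ctsC (pow_gap z n).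
Proof. intro Hz. unfold pow_gap. apply ctsC_minus; apply ctsC_pow; auto. Qed.

Lemma ctsC_dpow_gap z dz m : ctsC z -> ctsC dz -> ctsC (dpow_gap z dz m).
Proof.
  intros Hz Hdz. unfold dpow_gap.
  apply ctsC_minus;
    (apply ctsC_mult; [apply ctsC_mult; [apply ctsC_const|apply ctsC_pow; auto]|auto]).
Qed.

Lemma is_deriveC_pow_gap z dz m t :
  is_deriveC z t (dz t) -> is_deriveC (pow_gap z (S m)) t (dpow_gap z dz m t).
Proof. intro H. apply is_deriveC_minus; apply is_deriveC_pow; auto. Qed.

(** Put [N = m + 1], [x = a N t^2] with [a = c / 4], and [q = 1 / (1 + x)].
    The factor [z^m] is of order [q^4], while [t^2] is [x / (a N)]: every
    factor [t^2] gains [1 / N] and costs a factor [x], which is absorbed by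
    a [q].  The gap is of order [t^2 q^4] and its derivative of order
    [t (N t^2 + 1) q^4], so that their squares are at most constants times
    [q / N^2] and [q / N]; integrating the remaining [q] gives [1 / sqrt N]. *)
Lemma energy_pow_gap_le (z dz : R -> C) (c L : R) :
  ctsC z -> ctsC dz -> 0 < c -> 0 < L ->
  (forall t, Cmod (z t) <= 1) ->
  (forall t, - PI <= t <= PI ->
    Cmod (z t) <= 1 - c * t ^ 2 /\ Cmod (1 - z t)%C <= L * t ^ 2 /\
    Cmod (dz t) <= L * Rabs t) ->
  exists K, 0 < K /\ forall m,
    energy (pow_gap z (S m)) <= K / sqrt (INR (S m)) ^ 5 /\
    energy (dpow_gap z dz m) <= K / sqrt (INR (S m)) ^ 3.
Proof.
  intros Hz Hdz Hc HL Hz1 Hest.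
  pose proof PI_RGT_0 as HPI.
  set (a := c / 4). assert (Ha : 0 < a) by (unfold a; lra).
  set (ra := sqrt a). assert (Hra : 0 < ra) by (apply sqrt_lt_R0; auto).
  assert (Era : ra ^ 2 = a) by (apply pow2_sqrt; lra).
  (* [9] is the square of the constant of [pow_one_minus_le]; [2 * ra] comes from
     [energy_le] with [b = ra * sqrt N]. *)
  set (K0 := 9 * L ^ 2 / a ^ 2 / (2 * ra)).
  set (K1 := 9 * L ^ 2 * (L / a + 1) ^ 2 / a / (2 * ra)).
  assert (HLa : 0 < L / a) by (apply Rdiv_lt_0_compat; auto).
  assert (HK0 : 0 < K0).
  { unfold K0. repeat apply Rdiv_lt_0_compat; nra. }
  assert (HK1 : 0 < K1).
  { unfold K1. repeat apply Rdiv_lt_0_compat; nra. }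
  exists (K0 + K1). split; [lra|]. intro m.
  set (W := pow_gap z (S m)). set (dW := dpow_gap z dz m).
  assert (HW : ctsC W) by (apply ctsC_pow_gap; auto).
  assert (HdW : ctsC dW) by (apply ctsC_dpow_gap; auto).
  set (N := INR (S m)).
  assert (HN : 1 <= N).
  { unfold N. rewrite S_INR. pose proof (pos_INR m). lra. }
  fold N. set (s := sqrt N).
  assert (Hs : 1 <= s) by (rewrite <- sqrt_1; apply sqrt_le_1; lra).
  assert (Es : s ^ 2 = N) by (apply pow2_sqrt; lra).
  set (b := ra * s). assert (Hb : 0 < b) by (apply Rmult_lt_0_compat; lra).
  assert (Hpt : forall t, - PI <= t <= PI ->
    let x := a * N * t ^ 2 in let q := / (1 + (b * t) ^ 2) in
    0 <= x /\ 0 < q <= 1 /\ x * q <= 1 /\ q * (1 + x) = 1 /\ Cmod (z t) ^ m <= 3 * q ^ 4).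
  { intros t Ht x q. destruct (Hest t Ht) as (H1 & _).
    assert (Ex : (b * t) ^ 2 = x) by (unfold b, x; rewrite <- Era, <- Es; ring).
    assert (Hx : 0 <= x) by (rewrite <- Ex; apply pow2_ge_0).
    assert (Hq : q * (1 + x) = 1) by (unfold q; rewrite Ex; field; lra).
    assert (Hq0 : 0 < q) by (unfold q; rewrite Ex; apply Rinv_0_lt_compat; lra).
    pose proof (Cmod_ge_0 (z t)).
    repeat split; auto; try nra.
    eapply Rle_trans; [apply pow_incr; split; [apply Cmod_ge_0|exact H1]|].
    eapply Rle_trans; [apply pow_one_minus_le; split; [|lra]|].
    - pose proof (pow2_ge_0 t). nra.
    - apply Req_le. unfold q. rewrite Ex. unfold x, a. fold N.
      do 3 f_equal. f_equal. field. }
  assert (E0 : energy W <= (K0 + K1) / s ^ 5).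
  { apply Rle_trans with (9 * L ^ 2 / (a * N) ^ 2 / (2 * b)).
    - apply energy_le; auto. intros t Ht.
      destruct (Hpt t Ht) as (Hx & Hq & Hxq & Hq1 & Hzm). destruct (Hest t Ht) as (H1 & H2 & _).
      set (x := a * N * t ^ 2) in *. set (q := / (1 + (b * t) ^ 2)) in *.
      assert (Et : t ^ 2 = x / (a * N)) by (unfold x; field; lra).
      assert (HWt : Cmod (W t) <= 3 * q ^ 4 * (L * (x / (a * N)))).
      { unfold W, pow_gap. replace (z t ^ S m - z t ^ S (S m))%C with (z t ^ m * (z t * (1 - z t)))%C
          by (rewrite !Cpow_S; ring).
        rewrite !Cmod_mult, Cmod_pow. apply Rmult_le_compat; auto.
        - apply pow_le, Cmod_ge_0.
        - apply Rmult_le_pos; apply Cmod_ge_0.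
        - rewrite <- Et. rewrite <- (Rmult_1_l (L * t ^ 2)).
          apply Rmult_le_compat; auto using Cmod_ge_0. }
      apply Rle_trans with ((3 * q ^ 4 * (L * (x / (a * N)))) ^ 2).
      + apply pow_incr. split; [apply Cmod_ge_0|auto].
      + replace ((3 * q ^ 4 * (L * (x / (a * N)))) ^ 2)
          with (9 * L ^ 2 / (a * N) ^ 2 * (q * ((x * q) ^ 2 * q ^ 5))) by (field; lra).
        apply Rmult_le_compat_l.
        * apply Rlt_le, Rdiv_lt_0_compat; [nra|]. apply pow_lt. nra.
        * apply Rle_trans with (q * 1); [|lra]. apply Rmult_le_compat_l; [lra|].
          rewrite <- (Rmult_1_r 1).
          apply Rmult_le_compat; [apply pow2_ge_0|apply pow_le; lra| |].
          -- rewrite <- (pow1 2). apply pow_incr. split; auto. apply Rmult_le_pos; lra.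
          -- rewrite <- (pow1 5). apply pow_incr. lra.
    - apply Rle_trans with (K0 / s ^ 5).
      + apply Req_le. unfold K0, b. rewrite <- Es. field. lra.
      + apply Rmult_le_compat_r; [|lra]. apply Rlt_le, Rinv_0_lt_compat, pow_lt. lra. }
  assert (E1 : energy dW <= (K0 + K1) / s ^ 3).
  { apply Rle_trans with (9 * L ^ 2 * (L / a + 1) ^ 2 / (a * N) / (2 * b)).
    - apply energy_le; auto. intros t Ht.
      destruct (Hpt t Ht) as (Hx & Hq & Hxq & Hq1 & Hzm). destruct (Hest t Ht) as (H1 & H2 & H3).
      set (x := a * N * t ^ 2) in *. set (q := / (1 + (b * t) ^ 2)) in *.
      assert (Et : t ^ 2 = x / (a * N)) by (unfold x; field; lra).
      assert (HWt : Cmod (dW t) <= 3 * q ^ 4 * (L * Rabs t * ((L / a + 1) * / q))).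
      { unfold dW, dpow_gap. replace (RtoC (INR (S m)) * z t ^ m * dz t
            - RtoC (INR (S (S m))) * z t ^ S m * dz t)%C
          with (z t ^ m * (dz t * (RtoC N * (1 - z t) - z t)))%C
          by (rewrite (S_INR (S m)), RtoC_plus, !Cpow_S; unfold N; ring).
        rewrite !Cmod_mult, Cmod_pow. apply Rmult_le_compat; auto.
        - apply pow_le, Cmod_ge_0.
        - apply Rmult_le_pos; apply Cmod_ge_0.
        - apply Rmult_le_compat; auto using Cmod_ge_0.
          apply Rle_trans with (N * (L * t ^ 2) + 1).
          + unfold Cminus at 1. eapply Rle_trans; [apply Cmod_triangle|].
            rewrite Cmod_opp, Cmod_mult, Cmod_R, (Rabs_pos_eq N) by lra.
            apply Rplus_le_compat; [|apply Hz1].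
            apply Rmult_le_compat_l; [lra|auto].
          + replace (/ q) with (1 + x) by (unfold Rdiv; field_simplify_eq; lra).
            replace (N * (L * t ^ 2)) with (L / a * x) by (unfold x; field; lra). nra. }
      apply Rle_trans with ((3 * q ^ 4 * (L * Rabs t * ((L / a + 1) * / q))) ^ 2).
      + apply pow_incr. split; [apply Cmod_ge_0|auto].
      + replace ((3 * q ^ 4 * (L * Rabs t * ((L / a + 1) * / q))) ^ 2)
          with (9 * L ^ 2 * (L / a + 1) ^ 2 / (a * N) * (q * ((x * q) * q ^ 4))).
        2: { replace ((3 * q ^ 4 * (L * Rabs t * ((L / a + 1) * / q))) ^ 2)
               with (9 * L ^ 2 * (L / a + 1) ^ 2 * q ^ 6 * Rabs t ^ 2) by (field; lra).
             rewrite pow2_abs, Et. field. lra. }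
        apply Rmult_le_compat_l.
        * apply Rlt_le, Rdiv_lt_0_compat; [|nra]. apply Rmult_lt_0_compat; nra.
        * apply Rle_trans with (q * 1); [|lra]. apply Rmult_le_compat_l; [lra|].
          rewrite <- (Rmult_1_r 1).
          apply Rmult_le_compat; [apply Rmult_le_pos; lra|apply pow_le; lra|lra|].
          rewrite <- (pow1 4). apply pow_incr. lra.
    - apply Rle_trans with (K1 / s ^ 3).
      + apply Req_le. unfold K1, b. rewrite <- Es. field. lra.
      + apply Rmult_le_compat_r; [|lra]. apply Rlt_le, Rinv_0_lt_compat, pow_lt. lra. }
  split; [exact E0|exact E1].
Qed.

(** The numbers [conv_pow mu (S m) k - conv_pow mu (S (S m)) k] are the
    coefficients of [pow_gap (fourier mu) (S m)], whose energies are small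
    enough for [coef_abs_sum_le] to bound each half-sum by a multiple of
    [1 / (m + 1)]. *)
Lemma ritt_of_moments (mu : Z -> R)
  (mu_prob : is_probability mu)
  (mu_aper : strictly_aperiodic mu)
  (mu_mom2 : ex_Zsum (fun k : Z => (IZR k) ^ 2 * mu k))
  (mu_cent : is_Zsum (fun k : Z => IZR k * mu k) 0) :
  ritt mu.
Proof.
  destruct (fourier_estimates mu mu_prob mu_aper mu_mom2 mu_cent) as (c & L & Hc & HL & Hest).
  pose proof (prob_abs_sum mu mu_prob) as S0.
  pose proof (first_moment_abs_sum mu mu_prob mu_mom2) as S1.
  pose proof (second_moment_abs_sum mu mu_prob mu_mom2) as S2.
  set (z := fourier mu) in *.
  assert (Hz : ctsC z) by (apply ctsC_fourier; auto).
  assert (Hdz : ctsC (dfourier mu)).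
  { split; intro x; simpl; [apply continuous_Ropp, continuous_zsin|apply continuous_zcos]; auto. }
  destruct (energy_pow_gap_le z (dfourier mu) c L) as (K & HK & Hen); auto.
  { intro t; apply Cmod_fourier_le_1; auto. }
  { intros t Ht. destruct (Hest t Ht) as (? & ? & ? & _); auto. }
  (* [coef_abs_sum_le] gives [B / N] for each of the two half-sums. *)
  set (B := 3 / 2 + K).
  exists (2 * B). intros n Hn. destruct n as [|m]; [lia|].
  destruct (Hen m) as [E0 E1].
  set (W := pow_gap z (S m)) in *. set (dW := dpow_gap z (dfourier mu) m) in *.
  assert (HW : ctsC W) by (apply ctsC_pow_gap; auto).
  assert (HdW : ctsC dW) by (apply ctsC_dpow_gap; auto).
  assert (HD : forall t, is_deriveC W t (dW t)).
  { assert (Hdz1 : forall t, is_deriveC z t (dfourier mu t)).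
    { intro t. split.
      - apply (is_derive_ext (zcos mu)); [intro u; unfold z; now rewrite fourier_eq|].
        apply is_derive_zcos; auto.
      - apply (is_derive_ext (zsin mu)); [intro u; unfold z; now rewrite fourier_eq|].
        apply is_derive_zsin; auto. }
    intro t. apply is_deriveC_pow_gap; auto. }
  assert (Hper : W (- PI) = W PI).
  { unfold W, pow_gap, z. rewrite !fourier_eq, zcos_opp, zsin_opp, zsin_PI, Ropp_0. reflexivity. }
  set (N := INR (S m)).
  assert (HN : 1 <= N).
  { unfold N. rewrite S_INR. pose proof (pos_INR m). lra. }
  fold N in E0, E1. set (s := sqrt N) in *.
  assert (Hs : 1 <= s) by (rewrite <- sqrt_1; apply sqrt_le_1; lra).
  assert (Es : s ^ 2 = N) by (apply pow2_sqrt; lra).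
  assert (Hcoef : forall k, conv_pow mu (S m) k - conv_pow mu (S (S m)) k = coef W k).
  { intro k. rewrite !(conv_pow_coef mu mu_prob). unfold W, pow_gap.
    rewrite coef_minus; auto using ctsC_pow. }
  assert (Hhalf : forall e : nat -> Z, (forall m n, e m = e n -> m = n) ->
    (forall n, INR n ^ 2 <= IZR (e n) ^ 2) -> exists l,
    is_series (fun n => Rabs (conv_pow mu (S m) (e n) - conv_pow mu (S (S m)) (e n))) l /\ l <= B / N).
  { intros e He He2.
    destruct (is_series_bounded (fun n => Rabs (coef W (e n))) (B / N)) as (l & Hl & Hle).
    - intro; apply Rabs_pos.
    - intro j. rewrite <- Es.
      apply (coef_abs_sum_le W dW e s K HW HdW (fun t => proj1 (HD t))
        (fun t => proj2 (HD t)) Hper He He2 Hs E0 E1).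
    - exists l. split; auto. eapply is_series_ext; [|exact Hl]. intro j; simpl.
      now rewrite <- Hcoef. }
  destruct (Hhalf (fun n => Z.of_nat n)) as (l1 & Hl1 & Hb1).
  { intros; lia. }
  { intro j. rewrite <- INR_IZR_INZ. lra. }
  destruct (Hhalf (fun n => (- Z.of_nat (S n))%Z)) as (l2 & Hl2 & Hb2).
  { intros; lia. }
  { intro j. rewrite opp_IZR, <- INR_IZR_INZ, S_INR. pose proof (pos_INR j). nra. }
  exists (l1 + l2). split.
  - exists l1, l2. auto.
  - fold N. replace (2 * B) with (N * (B / N + B / N)) by (field; lra).
    apply Rmult_le_compat_l; lra.
Qed.

Theorem theorem1p3 (mu : Z -> R)
  (mu_prob : is_probability mu)
  (mu_aper : strictly_aperiodic mu)
  (mu_mom2 : ex_Zsum (fun k : Z => (IZR k) ^ 2 * mu k))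
  (mu_cent : is_Zsum (fun k : Z => IZR k * mu k) 0) :
  class_H mu /\ class_R mu.
Proof.
  split; split; auto using hypothesis_H_of_moments, ritt_of_moments.
Qed.
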